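(* Given any $\beta\in(\frac12,1)$, there exists a finitely generated nilpotent-by-cyclic group $G$ such that for any symmetric probability measure $\mu$ on $G$ with finite generating support, there are a constant $C>0$ and infinite sequences of times $(t_i)$ and $(n_i)$, tending to infinity, such that the drift function satisfies $L_\mu(t_i)\le C t_i^{1/2}$ for all $i$ and $L_\mu(n_i)\ge\frac1C n_i^{\beta}$ for all $i$.
   Context: A group is nilpotent-by-cyclic if it has a nilpotent normal subgroup with cyclic quotient. For a group $G$ with a fixed finite symmetric generating set $S$ and word metric $d_S$, the drift function of the random walk with step distribution $\mu$ is $L_\mu(n)=\sum_{x\in G}d_S(e,x)\,\mu^{(n)}(x)$, where $\mu^{(n)}$ is the $n$-fold convolution power of $\mu$. *)

(* Defs.v *)
From HB Require Import structures.
From mathcomp Require Import all_boot all_order all_algebra.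
From mathcomp Require Import all_classical all_reals all_analysis.

Set Implicit Arguments.
Unset Strict Implicit.
Unset Printing Implicit Defensive.

Import Order.TTheory GRing.Theory Num.Theory.
Import numFieldNormedType.Exports.

Local Open Scope classical_set_scope.
Local Open Scope group_scope.

(* [groupType] is the structure of arbitrary, possibly infinite, groups. *)
Section Groups.
Variable G : groupType.
Implicit Types (A B H N S : set G) (x y g : G) (n c : nat).

Definition is_subgroup H : Prop :=
  H 1 /\ forall x y, H x -> H y -> H (x / y).

Definition subgroup_gen A : set G := smallest is_subgroup A.

Definition generates A : Prop := subgroup_gen A = setT.

Definition finitely_generated : Prop :=
  exists2 A, finite_set A & generates A.

Definition is_normal N : Prop :=
  is_subgroup N /\ forall x g, N x -> N (x ^ g).

Definition commutator A B : set G :=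
  subgroup_gen [set z | exists2 x, A x & exists2 y, B y & z = [~ x, y]].

Fixpoint lower_central H n : set G :=
  if n is m.+1 then commutator (lower_central H m) H else H.

Definition nilpotent_subgroup H : Prop :=
  is_subgroup H /\ exists c, lower_central H c = [set 1].

Definition lcoset_set x N : set G := [set x * h | h in N].

(* For [N] normal, the elements of G/N are the cosets xN, and the powers of gN
   are the cosets (g ^ k)N with k an integer, here k = n or k = - n. *)
Definition cyclic_quotient N : Prop :=
  exists g, forall x, exists n,
    lcoset_set x N = lcoset_set (g ^+ n) N \/
    lcoset_set x N = lcoset_set (g ^- n) N.

Definition nilpotent_by_cyclic : Prop :=
  exists N, [/\ is_normal N, nilpotent_subgroup N & cyclic_quotient N].

Definition symmetric_set S : Prop := forall x, S x -> S x^-1.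

Definition is_word_length S x n : Prop :=
  exists w : seq G, [/\ forall s, s \in w -> S s, size w = n
                      & \prod_(s <- w) s = x].

(* Least length of a word over [S] representing [x]; the default value 0 is only
   taken when no such word exists, hence never when [S] is symmetric and
   generating. *)
Definition word_norm S x : nat :=
  xget 0%N [set n | is_word_length S x n /\
                    forall m, is_word_length S x m -> (n <= m)%N].

Definition word_metric S x y : nat := word_norm S (x^-1 * y).

End Groups.

Section RandomWalk.
Local Open Scope ring_scope.
Variables (R : realType) (G : groupType).
Implicit Types (mu nu : G -> R) (S : set G) (n : nat).

Definition mass_support mu : set G := [set x | mu x != 0].

(* The sum is a finitely supported one (it would be 0, hence not 1, if the support
   of [mu] were infinite), so these are the finitely supported probability
   measures on [G]; all the sums below then have finite support as well. *)
Definition finite_probability mu : Prop :=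
  [/\ forall x, 0 <= mu x, finite_set (mass_support mu)
    & \sum_(x \in [set: G]) mu x = 1].

Definition symmetric_measure mu : Prop := forall x, mu (x^-1)%g = mu x.

Definition convolution mu nu : G -> R :=
  fun x => \sum_(y \in [set: G]) mu y * nu (y^-1 * x)%g.

Definition dirac_mass1 : G -> R := fun x => (x == 1%g)%:R.

Definition convolution_power mu n : G -> R :=
  iter n (convolution mu) dirac_mass1.

Definition drift S mu n : R :=
  \sum_(x \in [set: G]) (word_metric S 1%g x)%:R * convolution_power mu n x.

End RandomWalk.

Arguments finitely_generated : clear implicits.
Arguments nilpotent_by_cyclic : clear implicits.

(* Main.v *)
Require Import Defs.
From HB Require Import structures.
From mathcomp Require Import all_boot all_order all_algebra.
From mathcomp Require Import all_classical all_reals all_analysis.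
From mathcomp Require Import zify ring lra.

Set Implicit Arguments.
Unset Strict Implicit.
Unset Printing Implicit Defensive.

Import Order.TTheory GRing.Theory Num.Theory.
Import numFieldNormedType.Exports.
Local Open Scope classical_set_scope.
Local Open Scope ring_scope.

(* The group is generated by a shift and two involutions A and B. For each scale l
   of a fast growing sequence it acts on a finite machine, whose state consists of
   a position X in Z/m, m = (d + 2) l, of a configuration g of bits indexed by Z/m,
   and of l^d further bits z_J. The shift moves X, A flips the bit of g at X, and B,
   when X = 0, adds to every z_J a product of d bits of g, read at distance at least
   l from X. The elements of total shift 0 act by g |-> g + h, z |-> z + P(g) with P
   of degree at most d, so they form a nilpotent group.

   A word much shorter than l cannot move A-flips into the windows read by B, so it
   acts at scale l as in the lamplighter group over Z. If two consecutive scales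
   are very far apart, then at suitable times t between them the length of the
   walker is, up to an additive constant, at most a multiple of the range of its
   projection to Z, which is of order t^(1/2) by a maximal inequality.

   At scale l, let f be a nonzero linear form on the bits z_J. Evaluated on the
   products of bits of g it is a nonzero d-linear form, so from every state one of
   2^d words of length O(l) (visit d sites, flip some of them, apply B at X = 0, come
   back) multiplies the character (-1)^(f.z) by -1. This gives a Poincare inequality
   with constant O(l^3), and hence the mean of the character at time n is at most
   2^m exp(- c n / l^3). At time n of order l^(d + 3) the l^d bits are thus close to
   uniform, so a ball of radius c l^d has small mass and the drift is at least of
   order l^d, where d / (d + 3) >= beta for d large. *)

(** * Polynomial maps between abelian groups *)

Section FiniteDegree.
Variables (U V : zmodType).
Implicit Types (P Q : U -> V) (j : nat).

(* [P] has degree less than [j]: all its [j]-fold finite differences vanish. *)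
Fixpoint finite_degree j P : Prop :=
  if j is j'.+1 then forall h, finite_degree j' (fun g => P (g + h) - P g)
  else forall g, P g = 0.

Lemma eq_finite_degree j P Q :
  P =1 Q -> finite_degree j P -> finite_degree j Q.
Proof. by move=> /funext ->. Qed.

Lemma finite_degree0 j : finite_degree j (fun=> 0).
Proof. by elim: j => //= j IH h; rewrite subrr. Qed.

Lemma finite_degreeD j P Q :
  finite_degree j P -> finite_degree j Q -> finite_degree j (fun g => P g + Q g).
Proof.
elim: j P Q => [|j IH] P Q /= hP hQ.
  by move=> g; rewrite hP hQ addr0.
move=> h; apply: eq_finite_degree (IH _ _ (hP h) (hQ h)) => g /=.
by rewrite opprD addrACA.
Qed.

Lemma finite_degreeN j P : finite_degree j P -> finite_degree j (fun g => - P g).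
Proof.
elim: j P => [|j IH] P /= hP; first by move=> g; rewrite hP oppr0.
by move=> h; apply: eq_finite_degree (IH _ (hP h)) => g; rewrite opprD opprK.
Qed.

Lemma finite_degree_shift j P u :
  finite_degree j P -> finite_degree j (fun g => P (g + u)).
Proof.
elim: j P => [|j IH] P /= hP; first by move=> g; rewrite hP.
by move=> h; apply: eq_finite_degree (IH _ (hP h)) => g; rewrite addrAC.
Qed.

End FiniteDegree.

Lemma finite_degree_ffun (U V : zmodType) (J : finType) j
    (P : U -> {ffun J -> V}) :
  (forall i, finite_degree j (fun g => P g i)) -> finite_degree j P.
Proof.
elim: j P => [|j IH] P /= hP; first by move=> g; apply/ffunP => i; rewrite hP ffunE.
move=> h; apply: IH => i.
by apply: eq_finite_degree (hP i h) => g; rewrite !ffunE.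
Qed.

Section FiniteDegreeProduct.
Variables (K : finType) (R : comNzRingType).

(** Product rule: the difference in direction [h] is the difference of [P] times [g k], plus the
    constant [h k] times a shift of [P]. *)
Lemma finite_degree_mul_coord j (P : {ffun K -> R} -> R) k :
  finite_degree j P -> finite_degree j.+1 (fun g => P g * g k).
Proof.
elim: j P => [|j IH] P hP.
  by move=> h g; rewrite !hP !mul0r subrr.
move=> h.
have h1 := IH _ (hP h).
have h2 (c : R) (Q : {ffun K -> R} -> R) i :
    finite_degree i Q -> finite_degree i (fun g => Q g * c).
  elim: i Q => [|i IHi] Q /= hQ; first by move=> g; rewrite hQ mul0r.
  by move=> u; apply: eq_finite_degree (IHi _ (hQ u)) => g; rewrite mulrBl.
apply: eq_finite_degree (finite_degreeD h1 (h2 (h k) _ _ (finite_degree_shift h hP))).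
by move=> g; rewrite !ffunE; ring.
Qed.

Lemma finite_degree_prod_coord (I : Type) (r : seq I) (f : I -> K) :
  finite_degree (size r).+1 (fun g : {ffun K -> R} => \prod_(i <- r) g (f i)).
Proof.
elim: r => [|i r IH]; first by move=> h g; rewrite !big_nil subrr.
apply: eq_finite_degree (finite_degree_mul_coord (f i) IH) => g.
by rewrite big_cons mulrC.
Qed.

End FiniteDegreeProduct.

(** * The machines and the group *)

Inductive letter := Shift | Unshift | LampA | LampB.

Definition inv_letter c :=
  match c with Shift => Unshift | Unshift => Shift | _ => c end.

Notation word := (seq letter).

Definition inv_word (u : word) : word := rev (map inv_letter u).

Fixpoint disp (u : word) : int :=
  match u with
  | Shift :: u => 1 + disp u
  | Unshift :: u => - 1 + disp u
  | _ :: u => disp u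
  | [::] => 0
  end.

Lemma disp_cat u v : disp (u ++ v) = disp u + disp v.
Proof. by elim: u => [|[] u IH] /=; rewrite ?add0r -?addrA ?IH. Qed.

Lemma disp_inv u : disp (inv_word u) = - disp u.
Proof.
rewrite /inv_word; elim: u => [//|c u IH] /=.
by rewrite rev_cons -cats1 disp_cat IH; case: c => /=; lia.
Qed.

Lemma disp_nseq_unshift n : disp (nseq n Unshift) = - n%:Z.
Proof. by elim: n => //= n ->; lia. Qed.

Lemma disp_nseq_shift n : disp (nseq n Shift) = n%:Z.
Proof. by elim: n => //= n ->; lia. Qed.

Section Level.
Variables (d l : nat).

(* All the windows, [offset i r] for i < d and r < l, lie in [l, (d + 1) l), which
   modulo the circumference is at distance at least [l] from 0 on both sides. *)
Definition circumference := (d.+2 * l)%N.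
Notation m := circumference.

Definition config := {ffun 'Z_m -> bool}.
Definition moments := {ffun {ffun 'I_d -> 'I_l} -> bool}.
Definition state := ('Z_m * config * moments)%type.

Definition offset (i r : nat) : nat := (l + i * l + r)%N.

Definition monomials (g : config) : moments :=
  [ffun J : {ffun 'I_d -> 'I_l} => \prod_(i < d) g (offset i (J i))%:R].

Definition spike (X : 'Z_m) : config := [ffun Y => Y == X].

Definition step (s : state) (c : letter) : state :=
  let: (X, g, z) := s in
  match c with
  | Shift => (X + 1, g, z)
  | Unshift => (X - 1, g, z)
  | LampA => (X, g + spike X, z)
  | LampB => (X, g, if X == 0 then z + monomials g else z)
  end.

Definition run (u : word) (s : state) : state := foldl step s u.

Lemma run_cat u v s : run (u ++ v) s = run v (run u s).
Proof. exact: foldl_cat. Qed.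

Lemma addff (J : finType) (g : {ffun J -> bool}) : g + g = 0.
Proof. by apply/ffunP => i; rewrite !ffunE; exact: addbb. Qed.

Lemma stepK s c : step (step s c) (inv_letter c) = s.
Proof.
case: s => [[X g] z]; case: c => /=; rewrite ?addrK ?subrK //.
  by rewrite -addrA addff addr0.
by case: (X == 0) => //=; rewrite -addrA addff addr0.
Qed.

Lemma runK u s : run (inv_word u) (run u s) = s.
Proof.
rewrite /inv_word; elim: u s => [//|c u IH] s /=.
by rewrite rev_cons -cats1 run_cat IH /= stepK.
Qed.

Lemma inv_wordK : involutive inv_word.
Proof.
move=> u; rewrite /inv_word map_rev revK -map_comp -[RHS]map_id.
by apply: eq_map; case.
Qed.

Lemma runVK u s : run u (run (inv_word u) s) = s.
Proof. by rewrite -{1}(inv_wordK u) runK. Qed.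

(** The positions visited do not depend on [g] and [z]. Hence flips translate [g] by a constant, and
    each [LampB] at position 0 adds [monomials], of degree at most [d], at a translate of [g]. *)
Lemma run_affine u (X : 'Z_m) : exists h P,
  finite_degree d.+1 P /\
  forall g z, run u (X, g, z) = (X + (disp u)%:~R, g + h, z + P g).
Proof.
elim: u X => [|c u IH] X.
  exists 0, (fun=> 0); split; first exact: finite_degree0.
  by move=> g z /=; rewrite !addr0.
case: c.
- have [h [P [dP hP]]] := IH (X + 1).
  by exists h, P; split => // g z; rewrite /= hP intrD addrA.
- have [h [P [dP hP]]] := IH (X - 1).
  by exists h, P; split => // g z; rewrite /= hP intrD addrA mulrNz.
- have [h [P [dP hP]]] := IH X.
  exists (spike X + h), (fun g => P (g + spike X)).
  split; first exact: finite_degree_shift.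
  by move=> g z; rewrite /= hP addrA.
- have [h [P [dP hP]]] := IH X.
  exists h, (fun g => (if X == 0 then monomials g else 0) + P g); split.
    apply: finite_degreeD => //; case: (X == 0); last exact: finite_degree0.
    apply: finite_degree_ffun => J.
    have := @finite_degree_prod_coord 'Z_m bool _ (index_enum 'I_d)
       (fun i => (offset i (J i))%:R).
    rewrite -[index_enum _]enumT size_enum_ord; apply: eq_finite_degree => g.
    by rewrite ffunE enumT.
  by move=> g z /=; rewrite hP; case: ifP => _; rewrite ?add0r ?addrA.
Qed.

End Level.

Section Subgroups.
Local Open Scope group_scope.

Lemma subgroup_gen_subgroup (G : groupType) (A : set G) : is_subgroup (subgroup_gen A).
Proof.
split=> [|x y hx hy M [hM AM]]; first by move=> M [[]].
by apply: hM.2; [apply: hx|apply: hy].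
Qed.

Lemma is_subgroupM (G : groupType) (A : set G) (x y : G) :
  is_subgroup A -> A x -> A y -> A (x * y).
Proof.
move=> [A1 AB] Ax Ay.
by rewrite -[y]invgK; apply: (AB) => //; rewrite -[y^-1]mul1g; exact: AB.
Qed.

Lemma lcoset_set_eq (G : groupType) (A : set G) (x y : G) :
  is_subgroup A -> A (x^-1 * y) -> lcoset_set x A = lcoset_set y A.
Proof.
move=> sA Axy.
have key a b : A (a^-1 * b) -> lcoset_set b A `<=` lcoset_set a A.
  move=> Auv _ [w Aw <-]; exists (a^-1 * b * w); first exact: is_subgroupM.
  by rewrite !mulgA mulgV mul1g.
apply/seteqP; split; apply: key => //.
by have := sA.2 _ _ sA.1 Axy; rewrite mul1g invgM invgK.
Qed.

End Subgroups.

(** * The group acting on all machines at once, and its nilpotent normal subgroup *)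

Section LevelGroup.
Variables (d : nat) (ls : nat -> nat).

Definition actions := forall s, state d (ls s) -> state d (ls s).

Definition word_action (u : word) : actions := fun s => @run d (ls s) u.

(** The word is only asserted to exist, so equality in the group is equality of the actions at all
    scales. *)
Definition level_group : Type := {k : actions | exists u, k = word_action u}.

HB.instance Definition _ := gen_eqMixin level_group.
HB.instance Definition _ := gen_choiceMixin level_group.

Definition elt (u : word) : level_group :=
  exist _ (word_action u) (ex_intro _ u erefl).

Definition word_of (x : level_group) : word := projT1 (cid (svalP x)).

Definition act (x : level_group) : actions := sval x.
Arguments act : clear implicits.

Lemma act_elt u s : act (elt u) s = run u.
Proof. by []. Qed.

Lemma act_inj x y : (forall s, act x s =1 act y s) -> x = y.
Proof.
case: x y => [x px] [y py] exy; apply: eq_exist.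
by apply: functional_extensionality_dep => s; apply/funext/exy.
Qed.

Lemma word_ofK x : elt (word_of x) = x.
Proof.
by apply: act_inj => s; rewrite /act /= /word_of; case: cid => u /= ->.
Qed.

Definition level_mul x y := elt (word_of x ++ word_of y).
Definition level_inv x := elt (inv_word (word_of x)).
Definition level_one := elt [::].

Lemma act_mul_subproof x y s st : act (level_mul x y) s st = act y s (act x s st).
Proof. by rewrite act_elt run_cat -{2}(word_ofK x) -{2}(word_ofK y). Qed.

Lemma level_mulA : associative level_mul.
Proof. by move=> x y z; apply: act_inj => s st; rewrite !act_mul_subproof. Qed.

Lemma level_mul1 : left_id level_one level_mul.
Proof. by move=> x; apply: act_inj => s st; rewrite !act_mul_subproof. Qed.

Lemma level_mulr1 : right_id level_one level_mul.
Proof. by move=> x; apply: act_inj => s st; rewrite !act_mul_subproof. Qed.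

Lemma level_mulV : left_inverse level_one level_inv level_mul.
Proof.
move=> x; apply: act_inj => s st; rewrite act_mul_subproof.
by rewrite -{1}(word_ofK x) !act_elt runVK.
Qed.

Lemma level_mulrV : right_inverse level_one level_inv level_mul.
Proof.
move=> x; apply: act_inj => s st; rewrite act_mul_subproof.
by rewrite -{2}(word_ofK x) !act_elt runK.
Qed.

HB.instance Definition _ := isGroup.Build level_group
  level_mulA level_mul1 level_mulr1 level_mulV level_mulrV.

Local Open Scope group_scope.
Implicit Types (x y : level_group) (u v : word).

Lemma act1 s st : act 1 s st = st.
Proof. by []. Qed.

Lemma actM x y s st : act (x * y) s st = act y s (act x s st).
Proof. exact: act_mul_subproof. Qed.

Lemma actVK x s st : act x s (act x^-1 s st) = st.
Proof. by rewrite -actM mulVg. Qed.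

Lemma actK x s st : act x^-1 s (act x s st) = st.
Proof. by rewrite -actM mulgV. Qed.

Lemma elt_cat u v : elt (u ++ v) = elt u * elt v.
Proof. by apply: act_inj => s st; rewrite actM !act_elt run_cat. Qed.

Lemma elt_inv u : elt (inv_word u) = (elt u)^-1.
Proof.
by apply: act_inj => s st; rewrite act_elt -{1}(actVK (elt u) st) act_elt runK.
Qed.

Lemma elt_cons c u : elt (c :: u) = elt [:: c] * elt u.
Proof. by rewrite -elt_cat. Qed.

Lemma level_group_fg : finitely_generated level_group.
Proof.
exists [set elt [:: Shift]; elt [:: Unshift]; elt [:: LampA]; elt [:: LampB]].
  by rewrite !finite_setU; do ![split]; exact: finite_set1.
apply/seteqP; split=> // x _; rewrite -(word_ofK x).
set A := [set _; _; _; _].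
have sA := @subgroup_gen_subgroup level_group A.
elim: (word_of x) => [|c u IH]; first exact: sA.1.
rewrite elt_cons; apply: (is_subgroupM sA) => //.
by move=> M [_]; apply; rewrite /A; case: c; [do 3 left|do 2 left; right|left; right|right].
Qed.

(** The nilpotent normal subgroup, defined through words because displacement is not yet known to
    depend only on the group element. *)
Definition lamp_subgroup : set level_group :=
  [set x | exists2 u, x = elt u & disp u = 0%R].

(** A filtration by degree, trivial for [j = 0]. The map [P] may vary with the scale and the
    position, its degree bound may not. *)
Definition unipotent j : set level_group :=
  [set x | forall s X, exists P, finite_degree j P /\
           forall g z, act x s (X, g, z) = (X, g, (z + P g)%R)].

Lemma lamp_subgroup_subgroup : is_subgroup lamp_subgroup.
Proof.
split; first by exists [::].
move=> _ _ [u -> du] [v -> dv]; exists (u ++ inv_word v).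
  by rewrite elt_cat elt_inv.
by rewrite disp_cat disp_inv du dv oppr0.
Qed.

Lemma lamp_affine x : lamp_subgroup x -> forall s X, exists h P,
  finite_degree d.+1 P /\
  forall g z, act x s (X, g, z) = (X, (g + h)%R, (z + P g)%R).
Proof.
move=> [u -> du] s X; have [h [P [dP hP]]] := @run_affine d (ls s) u X.
by exists h, P; split => // g z; rewrite act_elt hP du addr0.
Qed.

Lemma unipotent_subgroup j : is_subgroup (unipotent j).
Proof.
split.
  move=> s X; exists (fun=> 0%R); split; first exact: finite_degree0.
  by move=> g z; rewrite act1 addr0.
move=> x y hx hy s X.
have [P [dP hP]] := hx s X; have [Q [dQ hQ]] := hy s X.
exists (fun g => P g - Q g)%R; split.
  by apply: finite_degreeD => //; exact: finite_degreeN.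
move=> g z; rewrite actM hP -[RHS](actK y) hQ.
by rewrite -!addrA addNr addr0.
Qed.

Lemma lamp_affineV s X x (h : config d (ls s)) (P : config d (ls s) -> moments d (ls s)) :
  (forall g z, act x s (X, g, z) = (X, (g + h)%R, (z + P g)%R)) ->
  forall g z, act x^-1 s (X, g, z) = (X, (g - h)%R, (z - P (g - h))%R).
Proof.
by move=> hP g z; rewrite -[RHS](actK x) hP !subrK.
Qed.

Lemma act_comm s X x y (h k : config d (ls s))
    (P Q : config d (ls s) -> moments d (ls s)) :
  (forall g z, act x s (X, g, z) = (X, (g + h)%R, (z + P g)%R)) ->
  (forall g z, act y s (X, g, z) = (X, (g + k)%R, (z + Q g)%R)) ->
  forall g z, act [~ x, y] s (X, g, z) =
    (X, g, (z + (P (g - h - k) - P (g - h) + (Q (g - k) - Q (g - h - k))))%R).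
Proof.
move=> hx hy g z; rewrite commgEl conjgE !actM.
rewrite (lamp_affineV hx) (lamp_affineV hy) hx hy.
congr (_, _, _); first by rewrite (addrAC (g - h)%R) !subrK.
rewrite (addrAC (g - h)%R) subrK.
set p1 := P _; set p2 := P _; set q1 := Q _; set q2 := Q _.
rewrite -!addrA; congr (_ + _)%R.
by rewrite [RHS]addrA [RHS]addrACA [RHS]addrC -!addrA.
Qed.

(** Translations of [g] commute, so the commutator fixes [g]; it adds to [z] a signed sum of
    translates of [P] and [Q]. *)
Lemma commg_lamp x y : lamp_subgroup x -> lamp_subgroup y ->
  unipotent d.+1 [~ x, y].
Proof.
move=> hx hy s X.
have [h [P [dP hP]]] := lamp_affine hx X.
have [k [Q [dQ hQ]]] := lamp_affine hy X.
exists (fun g => P (g - h - k) - P (g - h) + (Q (g - k) - Q (g - h - k)))%R.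
split; last exact: act_comm.
have dP2 := finite_degree_shift (- h)%R (finite_degree_shift (- k)%R dP).
have dQ2 := finite_degree_shift (- h)%R (finite_degree_shift (- k)%R dQ).
have dP1 := finite_degree_shift (- h)%R dP.
have dQ1 := finite_degree_shift (- k)%R dQ.
by do !apply: finite_degreeD => //; exact: finite_degreeN.
Qed.

(** The terms in [Q] cancel because [x] does not move [g]. What remains is the difference of [P] in
    direction [- k], of degree one less. *)
Lemma commg_unipotent j x y : unipotent j.+1 x -> lamp_subgroup y ->
  unipotent j [~ x, y].
Proof.
move=> hx hy s X.
have [P [dP hP]] := hx s X.
have [k [Q [dQ hQ]]] := lamp_affine hy X.
have hP0 g z : act x s (X, g, z) = (X, (g + 0)%R, (z + P g)%R) by rewrite hP addr0.
exists (fun g => P (g - k) - P g)%R; split; first exact: (dP (- k)%R).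
by move=> g z; rewrite (act_comm hP0 hQ) !subr0 subrr addr0.
Qed.

Lemma lower_central_unipotent j : (j <= d.+1)%N ->
  lower_central lamp_subgroup j.+1 `<=` unipotent (d.+1 - j).
Proof.
elim: j => [_|j IH jd].
  rewrite subn0; apply: smallest_sub; first exact: unipotent_subgroup.
  by move=> _ [x hx [y hy ->]]; exact: commg_lamp.
apply: smallest_sub; first exact: unipotent_subgroup.
move=> _ [x hx [y hy ->]]; apply: commg_unipotent hy.
by rewrite subnSK //; apply: IH hx; exact: ltnW.
Qed.

Lemma lamp_subgroup_nilpotent : nilpotent_subgroup lamp_subgroup.
Proof.
split; first exact: lamp_subgroup_subgroup.
(* One commutator leads into [unipotent d.+1], and [d.+1] more lower the degree bound to 0. *)
exists d.+2; apply/seteqP; split => [x|_ ->].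
  move/lower_central_unipotent => /(_ (leqnn _)); rewrite subnn => hx.
  apply: act_inj => s [[X g] z]; have [P [dP ->]] := hx s X.
  by rewrite act1 dP addr0.
exact: (@subgroup_gen_subgroup level_group _).1.
Qed.

Lemma elt_nseq c n : elt (nseq n c) = elt [:: c] ^+ n.
Proof. by elim: n => [|n IH]; rewrite ?expg0 // expgS /= elt_cons IH. Qed.

Lemma level_group_nilpotent_by_cyclic : nilpotent_by_cyclic level_group.
Proof.
exists lamp_subgroup; split.
- split; first exact: lamp_subgroup_subgroup.
  move=> _ y [u -> du]; exists (inv_word (word_of y) ++ u ++ word_of y).
    by rewrite !elt_cat elt_inv word_ofK.
  by rewrite !disp_cat disp_inv du add0r addNr.
- exact: lamp_subgroup_nilpotent.
exists (elt [:: Shift]) => x; exists `|disp (word_of x)|%N.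
rewrite -(word_ofK x); set u := word_of x.
have [u0|u0] := leP 0%R (disp u); [left|right];
  apply: lcoset_set_eq (lamp_subgroup_subgroup) _; rewrite -elt_nseq -!elt_inv -elt_cat.
  exists (inv_word u ++ nseq `|disp u|%N Shift); rewrite ?word_ofK //.
  by rewrite disp_cat disp_inv disp_nseq_shift; lia.
exists (inv_word u ++ inv_word (nseq `|disp u|%N Shift)); rewrite ?word_ofK //.
by rewrite disp_cat !disp_inv disp_nseq_shift; lia.
Qed.

End LevelGroup.

Arguments act {d ls} x s st.

(** * Short words *)

Lemma Zp_int_eq0 m (k : int) : (1 < m)%N -> (k%:~R == 0 :> 'Z_m) = (m %| `|k|)%N.
Proof.
move=> m1; have nat_eq0 n : (n%:R == 0 :> 'Z_m) = (m %| n)%N.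
  by rewrite Zp_nat -val_eqE /= Zp_cast.
case: k => n; first by rewrite -pmulrn nat_eq0.
by rewrite NegzE mulrNz oppr_eq0 -pmulrn nat_eq0 abszN.
Qed.

(** Group the occurrences by value: each value contributes an even multiplicity. This transfers
    parity from sites of Z to residues modulo a circumference. *)
Lemma even_count (I : eqType) (r : seq I) (p : pred I) :
  (forall k, ~~ odd (count_mem k r)) -> ~~ odd (count p r).
Proof.
move=> hr; have -> : odd (count p r) = \big[addb/false]_(i <- r | p i) true.
  elim: r {hr} => [|i r IH]; first by rewrite big_nil.
  by rewrite big_cons /= oddD IH; case: (p i).
rewrite -big_undup_iterop_count big1 // => i _.
have -> n : iterop n addb true false = odd n.
  by case: n => // n; rewrite iteropS; elim: n => //= n ->.
exact/negbTE.
Qed.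

(** * Lamps over Z and short tours realising them *)

Section Positions.
Implicit Types (u v : word) (x : int).

(** Sites are recorded in Z and not modulo a circumference, so that the same data serve all
    scales. *)
Fixpoint positionsA x u : seq int :=
  match u with
  | Shift :: u => positionsA (x + 1) u
  | Unshift :: u => positionsA (x - 1) u
  | LampA :: u => x :: positionsA x u
  | LampB :: u => positionsA x u
  | [::] => [::]
  end.

Fixpoint positionsB x u : seq int :=
  match u with
  | Shift :: u => positionsB (x + 1) u
  | Unshift :: u => positionsB (x - 1) u
  | LampA :: u => positionsB x u
  | LampB :: u => x :: positionsB x u
  | [::] => [::]
  end.

Lemma positionsA_cat x u v :
  positionsA x (u ++ v) = positionsA x u ++ positionsA (x + disp u) v.
Proof.
by elim: u x => [|[] u IH] x /=; rewrite ?addr0 // IH // addrA.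
Qed.

Lemma positionsB_cat x u v :
  positionsB x (u ++ v) = positionsB x u ++ positionsB (x + disp u) v.
Proof.
by elim: u x => [|[] u IH] x /=; rewrite ?addr0 // IH // addrA.
Qed.

Lemma positionsA_inv x u : positionsA (x + disp u) (inv_word u) = rev (positionsA x u).
Proof.
rewrite /inv_word; elim: u x => [//|c u IH] x /=.
rewrite rev_cons -cats1 positionsA_cat -/(inv_word u) disp_inv.
case: c => /=; rewrite ?addrA IH ?cats0 //.
by rewrite addrK rev_cons -cats1.
Qed.

Lemma positionsB_inv x u : positionsB (x + disp u) (inv_word u) = rev (positionsB x u).
Proof.
rewrite /inv_word; elim: u x => [//|c u IH] x /=.
rewrite rev_cons -cats1 positionsB_cat -/(inv_word u) disp_inv.
case: c => /=; rewrite ?addrA IH ?cats0 //.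
by rewrite addrK rev_cons -cats1.
Qed.

Lemma positionsA_shift x u : positionsA x u = map (+%R x) (positionsA 0 u).
Proof.
elim: u x => [//|[] u IH] x /=.
- by rewrite (IH (0 + 1)) IH -map_comp; apply: eq_map => k /=; lia.
- by rewrite (IH (0 - 1)) IH -map_comp; apply: eq_map => k /=; lia.
- by rewrite IH addr0.
- by rewrite IH.
Qed.

Lemma positionsB_shift x u : positionsB x u = map (+%R x) (positionsB 0 u).
Proof.
elim: u x => [//|[] u IH] x /=.
- by rewrite (IH (0 + 1)) IH -map_comp; apply: eq_map => k /=; lia.
- by rewrite (IH (0 - 1)) IH -map_comp; apply: eq_map => k /=; lia.
- by rewrite IH.
- by rewrite IH addr0.
Qed.

(* [u] and [v] represent the same element of the wreath product of (Z/2)^2 by Z. *)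
Definition same_lamps u v :=
  [/\ disp u = disp v,
      forall k, odd (count_mem k (positionsA 0 u)) = odd (count_mem k (positionsA 0 v))
    & forall k, odd (count_mem k (positionsB 0 u)) = odd (count_mem k (positionsB 0 v))].

Lemma same_lamps_divr u v : same_lamps u v -> same_lamps (u ++ inv_word v) [::].
Proof.
move=> [duv eA eB]; split=> [|k|k] /=.
- by rewrite disp_cat disp_inv duv subrr.
- by rewrite positionsA_cat duv positionsA_inv count_cat count_rev oddD eA addbb.
- by rewrite positionsB_cat duv positionsB_inv count_cat count_rev oddD eB addbb.
Qed.

Fixpoint ranged (lo hi x : int) u : bool :=
  (lo <= x <= hi) &&
  match u with
  | Shift :: u => ranged lo hi (x + 1) u
  | Unshift :: u => ranged lo hi (x - 1) u
  | _ :: u => ranged lo hi x u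
  | [::] => true
  end.

Lemma ranged_size lo hi x u :
  lo + (size u)%:Z <= x -> x + (size u)%:Z <= hi -> ranged lo hi x u.
Proof.
elim: u x => [|c u IH] x /= h1 h2; first by apply/andP; split; lia.
by apply/andP; split; [lia|case: c; apply: IH; lia].
Qed.

Lemma ranged_positionsA lo hi x u k :
  ranged lo hi x u -> k \in positionsA x u -> lo <= k <= hi.
Proof.
elim: u x => [//|c u IH] x /= /andP[hx].
case: c => [/IH|/IH|hu|/IH] //; rewrite inE => /orP[/eqP -> //|].
exact: IH hu.
Qed.

Lemma ranged_positionsB lo hi x u k :
  ranged lo hi x u -> k \in positionsB x u -> lo <= k <= hi.
Proof.
elim: u x => [//|c u IH] x /= /andP[hx].
case: c => [/IH|/IH|/IH|hu] //; rewrite inE => /orP[/eqP -> //|].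
exact: IH hu.
Qed.

Lemma ranged_disp lo hi x u : ranged lo hi x u -> lo <= x + disp u <= hi.
Proof.
elim: u x => [|c u IH] x /= /andP[hx]; first by rewrite addr0.
by case: c => /= /IH //; lia.
Qed.

Lemma ranged_cat lo hi x u v :
  ranged lo hi x (u ++ v) = ranged lo hi x u && ranged lo hi (x + disp u) v.
Proof.
elim: u x => [|c u IH] x /=.
  by rewrite addr0 andbT; case: v => [|c v] /=; rewrite ?andbT ?andbb // andbA andbb.
by case: c; rewrite IH /= ?addrA !andbA.
Qed.

Fixpoint sweep (alpha beta : pred int) x n : word :=
  if n is n'.+1 then
    nseq (alpha x) LampA ++ nseq (beta x) LampB ++ Shift :: sweep alpha beta (x + 1) n'
  else [::].

(** Go left to [- a], sweep every site up to [b], then come back from [b + 1]: lamps supported in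
    the interval are produced in length linear in its size. *)
Definition tour alpha beta (a b c : nat) : word :=
  nseq a Unshift ++ sweep alpha beta (- a%:Z) (a + b).+1 ++ nseq c Unshift.

Lemma disp_sweep alpha beta x n : disp (sweep alpha beta x n) = n%:Z.
Proof.
elim: n x => //= n IH x; rewrite !disp_cat /= IH.
by case: (alpha x) (beta x) => -[] /=; lia.
Qed.

Lemma positionsA_nseq_unshift x n : positionsA x (nseq n Unshift) = [::].
Proof. by elim: n x => /=. Qed.

Lemma positionsB_nseq_unshift x n : positionsB x (nseq n Unshift) = [::].
Proof. by elim: n x => /=. Qed.

Lemma odd_count_sweepA alpha beta x n k :
  odd (count_mem k (positionsA x (sweep alpha beta x n))) =
  (x <= k < x + n%:Z) && alpha k.
Proof.
elim: n x => [|n IH] x /=; first by rewrite addr0; case: ltgtP.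
rewrite !positionsA_cat !count_cat !oddD.
have -> : positionsA (x + disp (nseq (alpha x) LampA)) (nseq (beta x) LampB) = [::].
  by case: (beta x).
have -> : x + disp (nseq (alpha x) LampA) + disp (nseq (beta x) LampB) = x.
  by case: (alpha x) (beta x) => -[] /=; rewrite !addr0.
rewrite /= IH; have [->|kx] := eqVneq k x.
  have -> : (x + 1 <= x) = false by lia.
  have -> : (x < x + n.+1%:Z) by lia.
  by rewrite lexx /=; case: (alpha x); rewrite //= eqxx.
have -> : (x + 1 <= k < x + 1 + n%:Z) = (x <= k < x + n.+1%:Z) by lia.
by case: (alpha x) => //=; rewrite eq_sym (negbTE kx).
Qed.

Lemma odd_count_sweepB alpha beta x n k :
  odd (count_mem k (positionsB x (sweep alpha beta x n))) =
  (x <= k < x + n%:Z) && beta k.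
Proof.
elim: n x => [|n IH] x /=; first by rewrite addr0; case: ltgtP.
rewrite !positionsB_cat !count_cat !oddD.
have -> : positionsB x (nseq (alpha x) LampA) = [::] by case: (alpha x).
have -> : x + disp (nseq (alpha x) LampA) = x by case: (alpha x); rewrite /= addr0.
have -> : x + disp (nseq (beta x) LampB) = x by case: (beta x); rewrite /= addr0.
rewrite /= IH; have [->|kx] := eqVneq k x.
  have -> : (x + 1 <= x) = false by lia.
  have -> : (x < x + n.+1%:Z) by lia.
  by rewrite lexx /=; case: (beta x); rewrite //= eqxx.
have -> : (x + 1 <= k < x + 1 + n%:Z) = (x <= k < x + n.+1%:Z) by lia.
by case: (beta x) => //=; rewrite eq_sym (negbTE kx).
Qed.

Lemma size_sweep alpha beta x n : (size (sweep alpha beta x n) <= 3 * n)%N.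
Proof.
elim: n x => //= n IH x; rewrite !size_cat /= !size_nseq; have := IH (x + 1).
by case: (alpha x) (beta x) => -[] /=; lia.
Qed.

Lemma tour_exists (a b : nat) u : ranged (- a%:Z) b%:Z 0 u ->
  exists v, same_lamps u v /\ (size v <= 5 * (a + b).+1)%N.
Proof.
move=> hu; set alpha := fun k => odd (count_mem k (positionsA 0 u)).
set beta := fun k => odd (count_mem k (positionsB 0 u)).
have := ranged_disp hu; rewrite add0r => /andP[d1 d2].
(* The sweep ends at [b + 1], so this many steps back lead to the endpoint of [u]. *)
pose c := `|(b%:Z + 1 - disp u)%R|%N; exists (tour alpha beta a b c); split; last first.
  rewrite /tour size_cat size_nseq size_cat size_nseq.
  by have := size_sweep alpha beta (- a%:Z) (a + b).+1; rewrite /c; lia.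
have out (r : seq int) k : (forall j, j \in r -> - a%:Z <= j <= b%:Z) ->
    odd (count_mem k r) = (- a%:Z <= k < - a%:Z + (a + b).+1%:Z) && odd (count_mem k r).
  move=> hr; have [kr|kr] := boolP (k \in r); last by rewrite (count_memPn kr) andbF.
  by have hk := hr _ kr; have -> : - a%:Z <= k < - a%:Z + (a + b).+1%:Z by lia.
split=> [|k|k].
- by rewrite /tour disp_cat disp_cat !disp_nseq_unshift disp_sweep /c; lia.
- rewrite /tour positionsA_cat positionsA_cat !positionsA_nseq_unshift cats0.
  rewrite disp_nseq_unshift add0r odd_count_sweepA; apply: out => j.
  exact: ranged_positionsA hu.
- rewrite /tour positionsB_cat positionsB_cat !positionsB_nseq_unshift cats0.
  rewrite disp_nseq_unshift add0r odd_count_sweepB; apply: out => j.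
  exact: ranged_positionsB hu.
Qed.

End Positions.

Section ShortWords.
Variables (d l : nat).
Hypothesis l_gt0 : (0 < l)%N.
Notation m := (circumference d l).

Lemma circumference_gt1 : (1 < m)%N.
Proof. rewrite /circumference; nia. Qed.

(** The offset lies in [[l, (d + 1) l)] and [k - x] is less than [l] in absolute value, so their
    difference lies strictly between 0 and [m]. *)
Lemma offset_avoids (k x : int) (i : 'I_d) (r : 'I_l) :
  `|k - x| < l%:Z -> x%:~R = 0 :> 'Z_m -> k%:~R <> (offset l i r)%:R :> 'Z_m.
Proof.
move=> kx x0 ko.
have : ((offset l i r)%:Z - (k - x))%:~R == 0 :> 'Z_m.
  by rewrite !rmorphB /= x0 ko -pmulrn subr0 subrr.
rewrite Zp_int_eq0 ?circumference_gt1 //.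
have := ltn_ord i; have := ltn_ord r; rewrite /offset /circumference => hr hi.
have hil : (i * l + l <= d * l)%N by nia.
case/dvdnP => q; set p := (i * l)%N in hil *.
have -> : (d.+2 * l = d * l + l + l)%N by nia.
set dl := (d * l)%N in hil *; case: q => [|q]; nia.
Qed.

(* While a path stays within a range shorter than [l], the windows read by
   [LampB] avoid all the sites where [LampA] has acted. *)
Lemma run_short u (lo hi x : int) (g0 g : config d l) (z : moments d l) :
  hi - lo < l%:Z -> ranged lo hi x u ->
  (forall Y, (forall k : int, lo <= k <= hi -> k%:~R != Y) -> g Y = g0 Y) ->
  run u (x%:~R, g, z) =
    ((x + disp u)%:~R,
     [ffun Y => g Y + odd (count (fun k : int => k%:~R == Y) (positionsA x u))],
     z + (if odd (count (fun k : int => k%:~R == 0 :> 'Z_m) (positionsB x u))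
          then monomials g0 else 0)).
Proof.
move=> lohi; elim: u x g z => [|c u IH] x g z.
  move=> _ _ /=; rewrite !addr0; congr (_, _, _).
  by apply/ffunP => Y; rewrite ffunE addr0.
move=> /= /andP[hx hu] hg; rewrite -/(run u _); case: c hu => hu.
- by move: (IH (x + 1) g z hu hg); rewrite {1}intrD => ->; rewrite addrA.
- by move: (IH (x - 1) g z hu hg); rewrite {1}intrB => ->; rewrite addrA.
- rewrite IH //=; last first.
    move=> Y hY; rewrite !ffunE hg //; have := hY _ hx.
    by rewrite eq_sym => /negbTE ->; rewrite addr0.
  congr (_, _, _); apply/ffunP => Y; rewrite !ffunE oddD -addrA.
  by congr (_ + _); rewrite eq_sym; case: (_ == Y); rewrite ?add0r.
- rewrite IH //=; congr (_, _, _).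
  (* When [LampB] acts at residue 0, the range [[lo, hi]] is within distance less than [l], so the
     windows still show [g0]. *)
  have -> : (if x%:~R == 0 :> 'Z_m then z + monomials g else z) =
      z + (if x%:~R == 0 :> 'Z_m then monomials g0 else 0).
    have [x0|] := eqVneq; last by rewrite addr0.
    congr (_ + _); apply/ffunP => J; rewrite !ffunE; apply: eq_bigr => i _.
    apply: hg => k hk; apply/eqP.
    by apply: offset_avoids x0; lia.
  rewrite -addrA oddD; congr (_ + _).
  by case: (x%:~R == 0); rewrite ?add0r //=; case: odd; rewrite ?addr0 ?addff.
Qed.

(** The path has range at most [2 * size u], so [run_short] applies. Trivial lamps then give an even
    number of flips at each residue and of uses of [LampB] at residue 0. *)
Lemma run_same_lamps_nil u (s : state d l) : (2 * size u < l)%N -> same_lamps u [::] -> run u s = s.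
Proof.
case: s => [[X g] z] szu [du eA eB].
have -> : X = ((X : nat)%:Z)%:~R by rewrite -pmulrn natr_Zp.
set x := _%:Z.
have hu : ranged (x - (size u)%:Z) (x + (size u)%:Z) x u by apply: ranged_size; lia.
have even p (r : seq int) : (forall k, odd (count_mem k r) = false) ->
    odd (count p (map (+%R x) r)) = false.
  move=> hr; rewrite count_map; apply/negbTE/even_count => k.
  by rewrite hr.
have hw : x + (size u)%:Z - (x - (size u)%:Z) < l%:Z by lia.
rewrite (@run_short u _ _ x g g z hw hu) //.
rewrite du addr0 positionsB_shift positionsA_shift even // addr0.
congr (_, _, _); apply/ffunP => Y; rewrite ffunE even ?addr0 //.
Qed.

End ShortWords.

(** * Random walks *)

Section WordNorm.
Variables (G : groupType) (S : set G).
Implicit Types (x y : G).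
Local Open Scope group_scope.

Lemma word_length1 : is_word_length S 1 0.
Proof. by exists [::]; split; rewrite ?big_nil. Qed.

Lemma word_lengthM x y m n : is_word_length S x m -> is_word_length S y n ->
  is_word_length S (x * y) (m + n).
Proof.
move=> [u [Su <- <-]] [v [Sv <- <-]]; exists (u ++ v).
split; rewrite ?size_cat ?big_cat //= => s.
by rewrite mem_cat => /orP[/Su|/Sv].
Qed.

Lemma word_length_gen x : S x -> is_word_length S x 1.
Proof.
by move=> Sx; exists [:: x]; split; rewrite ?big_seq1 // => s; rewrite inE => /eqP ->.
Qed.

Lemma word_length_exists : symmetric_set S -> generates S ->
  forall x, exists n, is_word_length S x n.
Proof.
move=> symS genS x.
have : subgroup_gen S x by rewrite genS.
suff sub : subgroup_gen S `<=` [set x | exists n, is_word_length S x n] by exact: sub.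
apply: smallest_sub => {x}; last by move=> x Sx; exists 1%N; exact: word_length_gen.
split; first by exists 0%N; exact: word_length1.
move=> x y [m hx] [n [v [Sv _ <-]]] /=.
elim: v Sv m x hx => [|s v IH] Sv m x hx.
  by exists m; rewrite big_nil divg1.
rewrite big_cons invgM mulgA.
have Ss : S s by apply: Sv; rewrite inE eqxx.
have [k hk] := IH (fun t tv => Sv _ (@mem_behead _ (s :: v) _ tv)) m x hx.
by exists (k + 1)%N; apply: word_lengthM hk (word_length_gen (symS _ Ss)).
Qed.

Lemma word_norm_spec x n : is_word_length S x n ->
  is_word_length S x (word_norm S x) /\ (word_norm S x <= n)%N.
Proof.
move=> hn; rewrite /word_norm; case: xgetP => [k _ [hk kmin]|/= none].
  by split => //; exact: kmin.
have ex : exists k, `[< is_word_length S x k >] by exists n; apply/asboolP.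
have [k /asboolP hk kmin] := ex_minnP ex.
by exfalso; apply: (none k); split => // j hj; apply: kmin; apply/asboolP.
Qed.

Lemma word_norm_le x n : is_word_length S x n -> (word_norm S x <= n)%N.
Proof. by move=> /word_norm_spec[]. Qed.

Lemma word_metric1 x : word_metric S 1 x = word_norm S x.
Proof. by rewrite /word_metric invg1 mul1g. Qed.

(** A list with repetitions: each step either stays or multiplies by an entry of [r], so the size is
    an exact power. *)
Fixpoint ball (r : seq G) n : seq G :=
  if n is n'.+1 then ball r n' ++ [seq x * s | x <- ball r n', s <- r] else [:: 1].

Lemma size_ball r n : size (ball r n) = ((size r).+1 ^ n)%N.
Proof.
by elim: n => //= n IH; rewrite size_cat size_allpairs IH expnS mulSn mulnC.
Qed.

Lemma mem_ball r n x k :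
  S = [set` r] -> is_word_length S x k -> (k <= n)%N -> x \in ball r n.
Proof.
move=> Sr; elim: n k x => [|n IH] k x.
  move=> [w [_ sw <-]]; rewrite leqn0 => /eqP k0.
  by rewrite k0 in sw; rewrite (size0nil sw) big_nil inE.
move=> [w [Sw sw <-]] kn /=; rewrite mem_cat.
case/lastP: w Sw sw => [|w s] Sw sw.
  by rewrite (IH 0%N) // big_nil; exact: word_length1.
apply/orP; right; rewrite big_rcons; apply: allpairs_f.
  apply: (IH (size w)); last by rewrite size_rcons in sw; rewrite -ltnS sw.
  by exists w; split => // t tw; apply: Sw; rewrite mem_rcons inE tw orbT.
by have := Sw s; rewrite mem_rcons inE eqxx Sr; exact.
Qed.

End WordNorm.

(** * Markov operators and expectations over trajectories *)

Section RandomWalk.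
Variables (R : realType) (G : groupType) (mu : G -> R) (T : seq G).
Hypothesis T_uniq : uniq T.
Hypothesis mu_ge0 : forall x, 0 <= mu x.
Hypothesis mu_out : forall x, x \notin T -> mu x = 0.
Hypothesis mu_sum : \sum_(x <- T) mu x = 1.

Definition right_mul (G' : groupType) (x y : G') : G' := (x * y)%g.

(** Markov operator of the walk driven by [mu] through a right action. It is used both on the group
    itself and on the states of a machine. *)
Definition avg (O : Type) (a : O -> G -> O) (F : O -> R) : O -> R :=
  fun o => \sum_(y <- T) mu y * F (a o y).

Lemma fsum_seq (r : seq G) (f : G -> R) : uniq r ->
  (forall x, x \notin r -> f x = 0) -> \sum_(x \in [set: G]) f x = \sum_(x <- r) f x.
Proof.
move=> ur fr; rewrite (fsbigE r) //; last by move=> x _ /fr.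
by apply: eq_bigl => x; rewrite in_setT.
Qed.

Lemma convolutionE nu x :
  convolution mu nu x = \sum_(y <- T) mu y * nu (y^-1 * x)%g.
Proof. by rewrite /convolution (fsum_seq T_uniq) // => y /mu_out ->; rewrite mul0r. Qed.

Lemma convolution_powerS n x :
  convolution_power mu n.+1 x = \sum_(y <- T) mu y * convolution_power mu n (y^-1 * x)%g.
Proof. exact: convolutionE. Qed.

Lemma convolution_power_support n :
  exists2 r, uniq r & forall x, x \notin r -> convolution_power mu n x = 0.
Proof.
elim: n => [|n [r ur IH]].
  by exists [:: 1%g] => // x; rewrite inE /convolution_power /= /dirac_mass1 => /negbTE ->.
exists (undup [seq (y * x)%g | y <- T, x <- r]); first exact: undup_uniq.
move=> x; rewrite mem_undup => xr.
rewrite convolution_powerS big_seq big1 // => y yT.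
rewrite IH ?mulr0 //; apply: contra xr => xr.
by apply/allpairsP; exists (y, y^-1 * x)%g; rewrite mulVKg.
Qed.

Lemma avg_translate n F (y x : G) :
  iter n (avg (@right_mul G)) (fun z => F (y * z)%g) x = iter n (avg (@right_mul G)) F (y * x)%g.
Proof.
elim: n x => //= n IH x; rewrite /avg; apply: eq_bigr => z _.
by rewrite IH /right_mul mulgA.
Qed.

(** Peel off the first step [y]: substituting [y * x] for [x] and using [avg_translate] moves it
    into [F]. *)
Lemma sum_convolution_power n (F : G -> R) :
  \sum_(x \in [set: G]) F x * convolution_power mu n x = iter n (avg (@right_mul G)) F 1%g.
Proof.
elim: n F => [|n IH] F.
  rewrite (@fsum_seq [:: 1%g]) //.
    by rewrite big_seq1 /convolution_power /= /dirac_mass1 eqxx mulr1.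
  by move=> x; rewrite inE /convolution_power /= /dirac_mass1 => /negbTE ->; rewrite mulr0.
have [r ur hr] := convolution_power_support n.+1.
rewrite (@fsum_seq r) //; last by move=> x /hr ->; rewrite mulr0.
under eq_bigr do rewrite convolution_powerS mulr_sumr.
rewrite exchange_big iterS /=; apply: eq_big_seq => y yT.
transitivity (\sum_(x <- r) mu y * (F x * convolution_power mu n (y^-1 * x)%g)).
  by apply: eq_bigr => x _; rewrite mulrCA.
rewrite -mulr_sumr.
have [->|mu0] := eqVneq (mu y) 0; first by rewrite !mul0r.
rewrite /right_mul mul1g -/(right_mul (G' := G)).
have := avg_translate n F y 1; rewrite mulg1 => <-; rewrite -IH; congr (_ * _).
have bij : bijective (fun x : G => (y * x)%g).
  by exists (fun x => (y^-1 * x)%g) => x; rewrite ?mulKg ?mulVKg.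
transitivity (\sum_(x \in [set: G]) F x * convolution_power mu n (y^-1 * x)%g); last first.
  by rewrite [LHS](reindex_fsbigT _ _ bij); apply: eq_fsbigr => x _; rewrite mulKg.
apply/esym/fsum_seq => //.
(* In a vanishing sum of nonnegative terms each term vanishes; as [mu y] is nonzero, so does the
   power at [y^-1 * x]. *)
move=> x /hr; rewrite convolution_powerS.
move=> /eqP; rewrite big_seq psumr_eq0 => [/allP/(_ y yT)|z _].
  by rewrite yT /= mulf_eq0 (negbTE mu0) => /eqP ->; rewrite mulr0.
rewrite mulr_ge0 //; elim: n {IH hr} (z^-1 * x)%g => [|n IH] t.
  by rewrite /convolution_power /= /dirac_mass1 ler0n.
by rewrite convolution_powerS sumr_ge0 // => s _; rewrite mulr_ge0.
Qed.

Fixpoint expect n (F : seq G -> R) : R :=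
  if n is n'.+1 then \sum_(y <- T) mu y * expect n' (fun w => F (y :: w)) else F [::].

Lemma iter_avg (O : Type) (a : O -> G -> O) (F : O -> R) n o :
  iter n (avg a) F o = expect n (fun w => F (foldl a o w)).
Proof.
elim: n o => //= n IH o; rewrite /avg; apply: eq_bigr => y _.
by rewrite IH.
Qed.

Lemma expect_le n F1 F2 :
  (forall w, size w = n -> all (mem T) w -> F1 w <= F2 w) -> expect n F1 <= expect n F2.
Proof.
elim: n F1 F2 => [|n IH] F1 F2 h /=; first exact: h.
rewrite big_seq [leRHS]big_seq; apply: ler_sum => y yT.
apply: ler_wpM2l => //; apply: IH => w sw aw.
by apply: h; rewrite /= ?sw ?yT.
Qed.

Lemma eq_expect n F1 F2 : F1 =1 F2 -> expect n F1 = expect n F2.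
Proof. by move=> /funext ->. Qed.

Lemma expectD n F1 F2 : expect n (fun w => F1 w + F2 w) = expect n F1 + expect n F2.
Proof.
elim: n F1 F2 => //= n IH F1 F2; rewrite -big_split /=; apply: eq_bigr => y _.
by rewrite IH mulrDr.
Qed.

Lemma expectZ n c F : expect n (fun w => c * F w) = c * expect n F.
Proof.
elim: n F => //= n IH F; rewrite mulr_sumr; apply: eq_bigr => y _.
by rewrite IH mulrCA.
Qed.

Lemma expect_cst n c : expect n (fun=> c) = c.
Proof. by elim: n => //= n IH; rewrite IH -mulr_suml mu_sum mul1r. Qed.

(** * Sums of symmetric steps: second moment and maximum *)

Section Maximum.
Hypothesis mu_sym : forall x, mu (x^-1)%g = mu x.
Variable delta : G -> R.
Hypothesis delta_inv : forall x, x \in T -> delta (x^-1)%g = - delta x.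

Fixpoint total (w : seq G) : R := if w is y :: w then delta y + total w else 0.

Lemma sum_invg (F : G -> R) :
  \sum_(y <- T) mu y * F y = \sum_(y <- T) mu y * F (y^-1)%g.
Proof.
pose f y := mu y * F y.
have f0 y : y \notin T -> f y = 0 by move=> /mu_out yT; rewrite /f yT mul0r.
have fV0 y : y \notin T -> f (y^-1)%g = 0.
  by move=> /mu_out yT; rewrite /f mu_sym yT mul0r.
have bij : bijective (fun x : G => (x^-1)%g) by exists (fun x => (x^-1)%g); exact: invgK.
transitivity (\sum_(y <- T) f y) => //.
rewrite -fsum_seq // (reindex_fsbigT _ _ bij) (@fsum_seq T) //.
by apply: eq_bigr => y _; rewrite /f mu_sym.
Qed.

Lemma expect_total_sym n (phi : R -> R) :
  expect n (fun w => phi (total w)) = expect n (fun w => phi (- total w)).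
Proof.
elim: n phi => [|n IH] phi /=; first by rewrite oppr0.
rewrite [RHS]sum_invg; apply: eq_big_seq => y yT; congr (_ * _).
rewrite (IH (fun t => phi (delta y + t))); apply: eq_expect => w.
by rewrite delta_inv // opprD opprK.
Qed.

Definition variance := \sum_(y <- T) mu y * delta y ^+ 2.

Lemma mean_eq0 : \sum_(y <- T) mu y * delta y = 0.
Proof.
suff : \sum_(y <- T) mu y * delta y = - \sum_(y <- T) mu y * delta y by lra.
rewrite {1}sum_invg -sumrN; apply: eq_big_seq => y yT.
by rewrite delta_inv // mulrN.
Qed.

Lemma expect_total_sqr n c :
  expect n (fun w => (c + total w) ^+ 2) = c ^+ 2 + n%:R * variance.
Proof.
elim: n c => [|n IH] c /=; first by rewrite addr0 mul0r addr0.
transitivity (\sum_(y <- T) (mu y * (c ^+ 2 + n%:R * variance) +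
   (c *+ 2 * (mu y * delta y) + mu y * delta y ^+ 2))).
  apply: eq_bigr => y _.
  rewrite (eq_expect _ (F2 := fun w => ((c + delta y) + total w) ^+ 2)).
    by rewrite IH; ring.
  by move=> w; rewrite addrA.
rewrite !big_split /= -mulr_suml mu_sum -mulr_sumr mean_eq0 mulr0 -/variance -natr1.
ring.
Qed.

(** At the square time [a ^ 2], the inequality [|t| <= t^2 / (2 a) + a / 2] replaces Cauchy-Schwarz
    and avoids square roots. *)
Lemma expect_abs_total a : (0 < a)%N ->
  expect (a ^ 2) (fun w => `|total w|) <= a%:R * (variance + 1) / 2.
Proof.
move=> a0; have aR : (0 : R) < a%:R by rewrite ltr0n.
have step w : `|total w| <= a%:R^-1 / 2 * (0 + total w) ^+ 2 + a%:R / 2.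
  rewrite add0r -(real_normK (num_real (total w))); set t := `|_|.
  rewrite -subr_ge0 (_ : _ - _ = (t - a%:R) ^+ 2 * (a%:R^-1 / 2)).
    by rewrite mulr_ge0 ?sqr_ge0 // divr_ge0 // ?invr_ge0 ltW.
  by field; rewrite gt_eqF.
apply: le_trans (expect_le (fun w _ _ => step w)) _.
rewrite expectD expectZ expect_cst expect_total_sqr expr0n add0r natrX.
rewrite le_eqVlt; apply/orP; left; apply/eqP.
by field; rewrite gt_eqF.
Qed.

End Maximum.

(** The maximum of the partial sums, the empty one included. It is needed over the integers for
    ranges of paths and over the reals for expectations. *)
Fixpoint peak (K : realDomainType) (delta : G -> K) (w : seq G) : K :=
  if w is y :: w then Num.max 0 (delta y + peak delta w) else 0.

Lemma peak_ge0 (K : realDomainType) (delta : G -> K) w : 0 <= peak delta w.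
Proof. by case: w => //= y w; rewrite le_max lexx. Qed.

Lemma peak_intr (delta : G -> int) w :
  (peak delta w)%:~R = peak (fun y => (delta y)%:~R) w :> R.
Proof.
elim: w => //= y w IH; rewrite -IH -intrD.
have [h|/ltW h] := leP 0 (delta y + peak delta w).
  by rewrite !max_r // ler0z.
by rewrite !max_l // lerz0.
Qed.

Lemma max0_add_max0 (K : realDomainType) (z t : K) : z <= 0 ->
  Num.max 0 (z + Num.max 0 t) = Num.max 0 (z + t).
Proof.
move=> z0; have [t0|/ltW t0] := leP t 0; last by [].
by rewrite addr0 !max_l //; lra.
Qed.

Lemma max0_addr (K : realDomainType) (z t : K) : 0 <= z -> 0 <= t ->
  Num.max 0 (z + t) = z + Num.max 0 (0 + t).
Proof. by move=> z0 t0; rewrite add0r !max_r //; lra. Qed.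

(* Levy's maximal inequality: by symmetry, a walk that has passed above 0 ends
   above 0 with probability at least 1/2. *)
Lemma expect_peak delta n y :
  (forall x, mu (x^-1)%g = mu x) -> (forall x, x \in T -> delta (x^-1)%g = - delta x) ->
  expect n (fun w => Num.max 0 (y + peak delta w)) <=
  2 * expect n (fun w => Num.max 0 (y + total delta w)).
Proof.
move=> mu_sym delta_inv.
(* Average over the sign of the total [t]: for [z >= 0], the positive parts of [z + t] and [z - t]
   add up to at least [z + |t|]. *)
have pos k z : 0 <= z ->
    2 * expect k (fun w => Num.max 0 (z + total delta w)) >=
    z + 2 * expect k (fun w => Num.max 0 (0 + total delta w)).
  move=> z0; have sym c := expect_total_sym mu_sym delta_inv k (fun t => Num.max 0 (c + t)).
  have : expect k (fun w => z + (Num.max 0 (0 + total delta w) +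
                                 Num.max 0 (0 - total delta w))) <=
         expect k (fun w => Num.max 0 (z + total delta w) + Num.max 0 (z - total delta w)).
    apply: expect_le => w _ _; move: (total _ _) => t.
    by rewrite /Num.max; do ![case: ltP => ?]; lra.
  by rewrite !expectD expect_cst -!sym; lra.
elim: n y => [|n IH] y.
  by rewrite /= !addr0 /Num.max; case: ltP => ?; lra.
(* From a start [z <= 0] the outer positive part absorbs the one inside [peak], so the first step
   reduces the claim to the induction hypothesis. *)
have nonpos z : z <= 0 ->
    expect n.+1 (fun w => Num.max 0 (z + peak delta w)) <=
    2 * expect n.+1 (fun w => Num.max 0 (z + total delta w)).
  move=> z0 /=; rewrite mulr_sumr; apply: ler_sum => x _.
  rewrite mulrCA; apply: ler_wpM2l => //.
  rewrite (eq_expect _ (F2 := fun w => Num.max 0 ((z + delta x) + peak delta w))).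
    rewrite [X in _ <= _ * X](eq_expect _ (F2 := fun w => Num.max 0 ((z + delta x) + total delta w))) //.
    by move=> w; rewrite addrA.
  by move=> w; rewrite -addrA; exact: max0_add_max0.
have [|/ltW y0] := leP y 0; first exact: nonpos.
(* A positive start can be taken out of the maximum, which leaves the case of start 0. *)
apply: le_trans (pos _ _ y0).
rewrite (eq_expect _ (F2 := fun w => y + Num.max 0 (0 + peak delta w))).
  by rewrite expectD expect_cst lerD2l; exact: nonpos.
by move=> w; apply: max0_addr => //; exact: peak_ge0.
Qed.

Lemma expect_peak_le delta a : (0 < a)%N ->
  (forall x, mu (x^-1)%g = mu x) -> (forall x, x \in T -> delta (x^-1)%g = - delta x) ->
  expect (a ^ 2) (peak delta) <= a%:R * (variance delta + 1).
Proof.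
move=> a0 mu_sym delta_inv.
have -> : expect (a ^ 2) (peak delta) =
    expect (a ^ 2) (fun w => Num.max 0 (0 + peak delta w)).
  by apply: eq_expect => w; rewrite add0r; apply/esym/max_idPr/peak_ge0.
apply: le_trans (expect_peak _ _ mu_sym delta_inv) _.
have := expect_abs_total mu_sym delta_inv a0.
have : expect (a ^ 2) (fun w => Num.max 0 (0 + total delta w)) <=
       expect (a ^ 2) (fun w => `|total delta w|).
  by apply: expect_le => w _ _; rewrite add0r ge_max normr_ge0 ler_norm.
lra.
Qed.

(** * The lazy walk and its comparison with the original walk *)

Definition lazy_avg (O : Type) (a : O -> G -> O) (F : O -> R) : O -> R :=
  fun o => (F o + avg a F o) / 2.

Lemma lazy_avg_le (O : Type) (a : O -> G -> O) (F1 F2 : O -> R) n o :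
  (forall o, F1 o <= F2 o) -> iter n (lazy_avg a) F1 o <= iter n (lazy_avg a) F2 o.
Proof.
move=> h; elim: n o => //= n IH o; rewrite /lazy_avg ler_pM2r ?invr_gt0 ?ltr0n //.
by rewrite lerD //; apply: ler_sum => y _; rewrite ler_wpM2l.
Qed.

Lemma avg_iter_lazy (O : Type) (a : O -> G -> O) (F : O -> R) n :
  avg a (iter n (lazy_avg a) F) = iter n (lazy_avg a) (avg a F).
Proof.
elim: n => //= n <-; apply/funext => o; rewrite /lazy_avg {1 3}/avg.
rewrite -big_split /= mulr_suml; apply: eq_bigr => y _.
by rewrite -mulrDr mulrA.
Qed.

Lemma iter_lazy_avgSr (O : Type) (a : O -> G -> O) (F : O -> R) n o :
  iter n.+1 (lazy_avg a) F o =
  (iter n (lazy_avg a) F o + iter n (lazy_avg a) (avg a F) o) / 2.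
Proof. by rewrite -avg_iter_lazy. Qed.

(* The lazy power is a convex combination of the powers [iter k (avg a)], k <= n;
   this frees the lower bound from parity problems, since some time k <= n does at
   least as well as the lazy walk. *)
Lemma lazy_avg_le_avg (O : Type) (a : O -> G -> O) (F : O -> R) n o :
  exists2 k, (k <= n)%N & iter n (lazy_avg a) F o <= iter k (avg a) F o.
Proof.
elim: n F => [|n IH] F; first by exists 0%N.
rewrite iter_lazy_avgSr.
have [k1 k1n h1] := IH F; have [k2 k2n] := IH (avg a F).
rewrite -iterSr => h2.
have [h|h] := leP (iter k1 (avg a) F o) (iter k2.+1 (avg a) F o).
  by exists k2.+1 => //; lra.
by exists k1; [exact: leqW|lra].
Qed.

Lemma lazy_avg_sum (O : Type) (a : O -> G -> O) (I : Type) (r : seq I)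
    (F : I -> O -> R) n o :
  iter n (lazy_avg a) (fun o => \sum_(i <- r) F i o) o =
  \sum_(i <- r) iter n (lazy_avg a) (F i) o.
Proof.
elim: n o => //= n IH o; rewrite /lazy_avg IH -mulr_suml big_split /=.
congr ((_ + _) / _); rewrite /avg exchange_big /=; apply: eq_bigr => y _.
by rewrite IH mulr_sumr.
Qed.

Lemma lazy_avgD (O : Type) (a : O -> G -> O) (F1 F2 : O -> R) n o :
  iter n (lazy_avg a) (fun o => F1 o + F2 o) o =
  iter n (lazy_avg a) F1 o + iter n (lazy_avg a) F2 o.
Proof.
elim: n o => //= n IH o; rewrite /lazy_avg IH -mulrDl [in RHS]addrACA.
congr ((_ + _) / _); rewrite /avg -big_split /=; apply: eq_bigr => y _.
by rewrite IH mulrDr.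
Qed.

Lemma lazy_avgZ (O : Type) (a : O -> G -> O) (F : O -> R) c n o :
  iter n (lazy_avg a) (fun o => c * F o) o = c * iter n (lazy_avg a) F o.
Proof.
elim: n o => //= n IH o; rewrite /lazy_avg IH mulrA mulrDr; congr ((_ + _) / _).
by rewrite /avg mulr_sumr; apply: eq_bigr => y _; rewrite IH mulrCA.
Qed.

Lemma lazy_avg_cst (O : Type) (a : O -> G -> O) c n o :
  iter n (lazy_avg a) (fun=> c) o = c.
Proof.
elim: n o => //= n IH o; rewrite /lazy_avg IH /avg.
rewrite (eq_bigr (fun y => mu y * c)) => [|y _]; last by rewrite IH.
by rewrite -mulr_suml mu_sum; field.
Qed.

(** Serves for the orbit map from the group to the states of one machine. *)
Lemma lazy_avg_comp (O O' : Type) (a : O -> G -> O) (a' : O' -> G -> O')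
    (h : O -> O') (F : O' -> R) n o :
  (forall o y, h (a o y) = a' (h o) y) ->
  iter n (lazy_avg a) (F \o h) o = iter n (lazy_avg a') F (h o).
Proof.
move=> ha; elim: n o => //= n IH o; rewrite /lazy_avg IH; congr ((_ + _) / _).
by rewrite /avg; apply: eq_bigr => y _; rewrite IH ha.
Qed.

End RandomWalk.

(** * Decay of the characters *)

Lemma sqr_sub_le (K : realFieldType) (k p q r : K) : 0 < k ->
  (p - r) ^+ 2 <= (1 + k^-1) * (p - q) ^+ 2 + (1 + k) * (q - r) ^+ 2.
Proof.
move=> k0; rewrite -subr_ge0 (_ : _ - _ = (p - q - k * (q - r)) ^+ 2 / k).
  by rewrite divr_ge0 ?sqr_ge0 // ltW.
by field; rewrite gt_eqF.
Qed.

Section Gradient.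
Variables (R : realType) (O : finType).
Implicit Types (Psi : O -> R) (phi : O -> O).

Definition gradient Psi phi : R := \sum_o (Psi o - Psi (phi o)) ^+ 2.

Lemma gradient_ge0 Psi phi : 0 <= gradient Psi phi.
Proof. by apply: sumr_ge0 => o _; exact: sqr_ge0. Qed.

(** Telescope along the word. All intermediate maps permute the finite set, so each letter
    contributes at most [M], and Cauchy-Schwarz yields the square of the length. *)
Lemma gradient_foldl (I : Type) (P : pred I) (a : O -> I -> O) Psi (M : R) (w : seq I) :
  (forall i, injective (a^~ i)) -> (forall i, P i -> gradient Psi (a^~ i) <= M) ->
  all P w -> gradient Psi (fun o => foldl a o w) <= (size w)%:R ^+ 2 * M.
Proof.
move=> inj_a aM; elim/last_ind: w => [_|w i IH].
  rewrite /gradient big1 => [|o _]; first by rewrite expr0n mul0r.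
  by rewrite subrr expr0n.
rewrite all_rcons => /andP[Pi /IH {}IH].
have inj_w : injective (fun o => foldl a o w).
  by elim: w {IH} => //= j w IHw o1 o2 /IHw /inj_a.
have [w0|w0] := posnP (size w).
  by rewrite (size0nil w0) /= expr1n mul1r; exact: aM.
(* This weight is chosen for [(1 + 1/k) k^2 + (1 + k) = (k + 1)^2]. *)
set k : R := (size w)%:R; have k0 : 0 < k by rewrite ltr0n.
have step o : (Psi o - Psi (foldl a o (rcons w i))) ^+ 2 <=
    (1 + k^-1) * (Psi o - Psi (foldl a o w)) ^+ 2 +
    (1 + k) * (Psi (foldl a o w) - Psi (a (foldl a o w) i)) ^+ 2.
  by rewrite foldl_rcons; exact: sqr_sub_le.
apply: le_trans (ler_sum _ (fun o _ => step o)) _.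
rewrite big_split /= -!mulr_sumr.
have -> : \sum_o (Psi (foldl a o w) - Psi (a (foldl a o w) i)) ^+ 2 = gradient Psi (a^~ i).
  by rewrite /gradient [RHS](reindex_inj inj_w).
rewrite size_rcons -natr1 -/k.
have -> : (k + 1) ^+ 2 * M = (1 + k^-1) * (k ^+ 2 * M) + (1 + k) * M.
  by move: k k0 {step} => k k0; field; rewrite gt_eqF.
by rewrite lerD // ler_wpM2l ?addr_ge0 ?invr_ge0 ?aM // ltW.
Qed.

End Gradient.

(** * Probing words and the Poincare inequality *)

Section Probe.
Variables (R : realType) (d l : nat).
Hypothesis l_gt0 : (0 < l)%N.
Notation m := (circumference d l).
Implicit Types (X Y : 'Z_m) (g : config d l) (z f : moments d l).

Definition pair f z : bool := \sum_J f J * z J.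

Lemma pairD f z1 z2 : pair f (z1 + z2) = pair f z1 + pair f z2.
Proof. by rewrite /pair -big_split; apply: eq_bigr => J _; rewrite ffunE mulrDr. Qed.

Lemma pairDl f1 f2 z : pair (f1 + f2) z = pair f1 z + pair f2 z.
Proof. by rewrite /pair -big_split; apply: eq_bigr => J _; rewrite ffunE mulrDl. Qed.

Definition character f z : R := (-1) ^+ pair f z.

Lemma characterD f z1 z2 : character f (z1 + z2) = character f z1 * character f z2.
Proof. by rewrite /character pairD signr_addb. Qed.

Lemma character_sqr f z : character f z ^+ 2 = 1.
Proof. by rewrite sqrr_sign. Qed.

Lemma characterDl f1 f2 z : character (f1 + f2) z = character f1 z * character f2 z.
Proof. by rewrite /character pairDl signr_addb. Qed.

Lemma sum_character z :
  \sum_f character f z = if z == 0 then 2%:R ^+ (l ^ d) else 0.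
Proof.
have [->|z0] := eqVneq.
  rewrite (eq_bigr (fun=> 1)) => [|f _].
    rewrite sumr_const -[#|_|]/#|{: moments d l}| card_ffun card_bool card_ffun !card_ord.
    by rewrite -natrX.
  by rewrite /character /pair big1 // => J _; rewrite ffunE mulr0.
have [J zJ] : exists J, z J.
  apply/existsP; apply: contraNT z0 => /existsPn h.
  by apply/eqP/ffunP => J; rewrite ffunE; apply/negbTE/h.
pose e : moments d l := [ffun J' => J' == J].
have eJ : character e z = -1.
  rewrite /character (_ : pair e z = true) // /pair (bigD1 J) //= big1 => [|i iJ].
    by rewrite addr0 ffunE eqxx zJ.
  by rewrite ffunE (negbTE iJ) mul0r.
(* Translation by [e], which pairs to 1 with [z], permutes the forms and changes the sign of the
   sum. *)
suff : \sum_f character f z = - \sum_f character f z by lra.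
rewrite {1}(reindex_inj (addrI e)) /= -sumrN; apply: eq_bigr => f _.
by rewrite characterDl eJ mulN1r.
Qed.

Definition site (i : 'I_d) (r : 'I_l) : 'Z_m := (offset l i r)%:R.

Lemma site_inj i1 r1 i2 r2 : site i1 r1 = site i2 r2 -> i1 = i2 /\ r1 = r2.
Proof.
have lt_site (i : 'I_d) (r : 'I_l) : (offset l i r < m)%N.
  have := ltn_ord i; have := ltn_ord r; rewrite /offset /circumference => hr hi.
  have : (i * l + l <= d * l)%N by nia.
  by set p := (i * l)%N; rewrite !mulSn; lia.
move=> /(congr1 (@nat_of_ord _)); rewrite /site !val_Zp_nat ?circumference_gt1 //.
rewrite !modn_small ?lt_site // /offset -!addnA => /addnI e.
have l0 := l_gt0; have ei : (i1 = i2 :> nat).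
  have := congr1 (fun n => (n %/ l)%N) e.
  by rewrite !divnMDl // !divn_small ?ltn_ord // !addn0.
by split; apply: val_inj => //=; move: e; rewrite ei => /addnI.
Qed.

Definition flips (ps : seq ('Z_m * bool)) : config d l :=
  \sum_(p <- ps) (if p.2 then spike p.1 else 0).

Definition travel X Y : word := nseq (Y - X)%R Shift.

Fixpoint flip_word X (ps : seq ('Z_m * bool)) : word :=
  if ps is p :: ps then travel X p.1 ++ nseq p.2 LampA ++ flip_word p.1 ps
  else travel X 0.

(** A conjugate of [LampB]: started at [X], it restores position and configuration and adds to [z]
    the monomials of the flipped configuration. *)
Definition probe X ps : word :=
  flip_word X ps ++ LampB :: inv_word (flip_word X ps).

Lemma run_nseq_shift n X g z : run (nseq n Shift) (X, g, z) = (X + n%:R, g, z).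
Proof.
elim: n X => [|n IH] X /=; first by rewrite addr0.
by rewrite -/(run _ _) IH -addrA -nat1r.
Qed.

Lemma run_travel X Y g z : run (travel X Y) (X, g, z) = (Y, g, z).
Proof. by rewrite run_nseq_shift natr_Zp addrC subrK. Qed.

Lemma run_flip_word X ps g z :
  run (flip_word X ps) (X, g, z) = (0, g + flips ps, z).
Proof.
elim: ps X g => [|[Y e] ps IH] X g /=.
  by rewrite run_travel /flips big_nil addr0.
rewrite !run_cat run_travel /flips big_cons -/(flips ps) /=.
by case: e; rewrite IH ?add0r ?addrA.
Qed.

Lemma run_probe X ps g z :
  run (probe X ps) (X, g, z) = (X, g, z + monomials (g + flips ps)).
Proof.
rewrite /probe run_cat run_flip_word /= ?eqxx -/(run _ _).
by rewrite -(run_flip_word X) runK.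
Qed.

Lemma size_travel X Y : (size (travel X Y) <= m)%N.
Proof.
rewrite size_nseq ltnW //; apply: leq_trans (ltn_ord _) _.
by rewrite Zp_cast // circumference_gt1.
Qed.

Lemma size_probe X ps : (size (probe X ps) <= 6 * (size ps).+1 * m)%N.
Proof.
have m1 : (1 < m)%N by exact: circumference_gt1.
have : (size (flip_word X ps) <= (size ps).+1 * m.+1)%N.
  elim: ps X => [|[Y e] ps IH] X /=.
    by have := size_travel X 0; lia.
  rewrite !size_cat size_nseq /=; have := IH Y; have := size_travel X Y.
  by case: e => /=; rewrite mulSn; lia.
rewrite /probe size_cat /= /inv_word size_rev size_map; nia.
Qed.

Variables (f : moments d l) (J0 : {ffun 'I_d -> 'I_l}).
Hypothesis fJ0 : f J0.

Definition cube_flips (e : {ffun 'I_d -> bool}) : seq ('Z_m * bool) :=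
  [seq (site i (J0 i), e i) | i <- enum 'I_d].

Lemma flips_cubeE e i r :
  flips (cube_flips e) (site i r) = e i * (r == J0 i) :> bool.
Proof.
rewrite /flips /cube_flips big_map big_enum /= sum_ffunE (bigD1 i) //=.
rewrite big1 => [|j ji]; last first.
  case: (e j); rewrite !ffunE //; apply/negbTE; apply: contra ji => /eqP.
  by move=> /site_inj[->].
rewrite addr0; case: (e i); rewrite ?ffunE ?mul0r // mul1r.
by apply/eqP/eqP => [/site_inj[]//|->].
Qed.

(* The top-degree finite difference of the multilinear form along the cube
   isolates the coefficient [f J0]. *)
Lemma sum_cube g : \sum_e pair f (monomials (g + flips (cube_flips e))) = true.
Proof.
rewrite /pair exchange_big /= (bigD1 J0) //= [X in _ + X]big1 => [|J JJ0].
  rewrite addr0 -mulr_sumr fJ0 mul1r.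
  under eq_bigr do rewrite ffunE.
  rewrite (eq_bigr (fun e : {ffun 'I_d -> bool} =>
     \prod_(i < d) (g (site i (J0 i)) + e i))) => [|e _].
    (* The sum over the cube factors, and each factor is [g + (g + 1) = 1] in the field with two
       elements. *)
    rewrite -(bigA_distr_bigA (fun i (b : bool) => g (site i (J0 i)) + b)) /=.
    apply: big1 => i _; rewrite big_bool /=; case: (g _) => //.
  by apply: eq_bigr => i _; rewrite ffunE flips_cubeE eqxx mulr1.
rewrite -mulr_sumr; under eq_bigr do rewrite ffunE.
rewrite (eq_bigr (fun e : {ffun 'I_d -> bool} =>
   \prod_(i < d) (g (site i (J i)) + e i * (J i == J0 i)))) => [|e _]; last first.
  by apply: eq_bigr => i _; rewrite ffunE flips_cubeE.
rewrite -(bigA_distr_bigA (fun i (b : bool) => g (site i (J i)) + b * (J i == J0 i))) /=.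
(* In the factor at [i] the flip does not touch the bit that is read, so its two equal values
   cancel. *)
have [i iJ] : exists i, J i != J0 i.
  by apply/existsP; apply: contraNT JJ0 => /existsPn h; apply/eqP/ffunP => i; apply/eqP;
    have := h i; rewrite negbK.
rewrite (bigD1 i) //= big_bool /= (negbTE iJ) !mulr0 addr0.
have -> b : b + b = 0 :> bool by exact: addbb.
by rewrite mul0r mulr0.
Qed.

(** The component of the functions on states on which translations of [z] act through the character
    of [f]. *)
Definition equivariant (Psi : state d l -> R) : Prop :=
  forall X g z z', Psi (X, g, z + z') = character f z' * Psi (X, g, z).

(** From every state some probe changes the sign of [Psi], so [4 Psi^2] is one of the terms [dev].
    Summing over all [2^d m] probes makes the words independent of the state, and [gradient_foldl]
    bounds each sum. *)
Lemma poincare (Psi : state d l -> R) (M : R) : equivariant Psi ->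
  (forall c, gradient Psi (fun s => step s c) <= M) ->
  \sum_s Psi s ^+ 2 <= (9 * 2 ^ d * d.+1 ^ 2 * m ^ 3)%:R * M.
Proof.
move=> eqPsi PsiM; pose dev s X e := (Psi s - Psi (run (probe X (cube_flips e)) s)) ^+ 2.
have dev_ge0 s X e : 0 <= dev s X e by exact: sqr_ge0.
have lb s : 4 * Psi s ^+ 2 <= \sum_X \sum_e dev s X e.
  case: s => [[X g] z].
  have [e he] : exists e, pair f (monomials (g + flips (cube_flips e))).
    apply/existsP; apply: contraT => /existsPn h; have := sum_cube g.
    by rewrite big1 // => e _; apply/negbTE/h.
  rewrite (bigD1 X) //= (bigD1 e) //= -addrA.
  have -> : dev (X, g, z) X e = 4 * Psi (X, g, z) ^+ 2.
    by rewrite /dev run_probe eqPsi /character he; ring.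
  by rewrite lerDl addr_ge0 // sumr_ge0 // => Y _; rewrite sumr_ge0.
have ub X e : \sum_s dev s X e <= (6 * d.+1 * m)%:R ^+ 2 * M.
  have M0 : 0 <= M by apply: le_trans (PsiM LampA); exact: gradient_ge0.
  apply: le_trans (gradient_foldl (P := predT) (a := @step d l) _ (fun c _ => PsiM c)
                                  (all_predT (probe X (cube_flips e)))) _.
    move=> c s1 s2 /= /(congr1 (fun s => step s (inv_letter c))).
    by rewrite !stepK.
  rewrite ler_wpM2r // lerXn2r ?nnegrE // ler_nat.
  by apply: leq_trans (size_probe _ _) _; rewrite size_map size_enum_ord.
rewrite -(ler_pM2l (ltr0n R 4)) mulr_sumr.
apply: le_trans (ler_sum _ (fun s _ => lb s)) _.
rewrite exchange_big /=; under eq_bigr do rewrite exchange_big /=.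
apply: le_trans (ler_sum _ (fun X _ => ler_sum _ (fun e _ => ub X e))) _.
rewrite !sumr_const card_ffun card_bool !card_ord Zp_cast ?circumference_gt1 //.
rewrite -mulrnA -natrX -[leLHS]mulr_natl !mulrA -!natrM.
rewrite (_ : 2 ^ d * m * (6 * d.+1 * m) ^ 2 = 4 * (9 * 2 ^ d * d.+1 ^ 2 * m ^ 3))%N //.
by move: (2 ^ d)%N d.+1 m => p q c; rewrite !expnS !expn0 !muln1; ring.
Qed.

End Probe.

(** * Contraction of the lazy walk along nontrivial characters *)

Section LazyContraction.
Variables (R : realType) (G : groupType) (mu : G -> R) (T : seq G).
Hypothesis mu_ge0 : forall x, 0 <= mu x.
Hypothesis mu_sum : \sum_(x <- T) mu x = 1.
Variables (O : finType) (a : O -> G -> O).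
Hypothesis a_inj : forall y, injective (a^~ y).

Lemma jensen_sqr (c : G -> R) :
  (\sum_(y <- T) mu y * c y) ^+ 2 <= \sum_(y <- T) mu y * c y ^+ 2.
Proof.
set S := \sum_(y <- T) mu y * c y; rewrite -subr_ge0.
have -> : \sum_(y <- T) mu y * c y ^+ 2 - S ^+ 2 = \sum_(y <- T) mu y * (c y - S) ^+ 2.
  transitivity (\sum_(y <- T) (mu y * c y ^+ 2 + (- (2 * S) * (mu y * c y) + mu y * S ^+ 2))).
    by rewrite !big_split /= -mulr_sumr -mulr_suml mu_sum -/S; ring.
  by apply: eq_bigr => y _; ring.
by apply: sumr_ge0 => y _; rewrite mulr_ge0 ?sqr_ge0.
Qed.

Definition energy (Psi : O -> R) : R := \sum_(y <- T) mu y * gradient Psi (a^~ y).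

(** Jensen's inequality and [((p + q)/2)^2 = (p^2 + q^2)/2 - (p - q)^2/4]; as the action is by
    permutations, both squares have the same sum over the states. *)
Lemma lazy_contraction (Psi : O -> R) :
  \sum_o lazy_avg mu T a Psi o ^+ 2 <= \sum_o Psi o ^+ 2 - energy Psi / 4.
Proof.
have step o : lazy_avg mu T a Psi o ^+ 2 <= \sum_(y <- T) mu y *
    ((Psi o ^+ 2 + Psi (a o y) ^+ 2) / 2 - (Psi o - Psi (a o y)) ^+ 2 / 4).
  have -> : lazy_avg mu T a Psi o = \sum_(y <- T) mu y * ((Psi o + Psi (a o y)) / 2).
    rewrite /lazy_avg -[X in X + _]mul1r -mu_sum mulr_suml /avg -big_split mulr_suml.
    by apply: eq_bigr => y _ /=; ring.
  apply: le_trans (jensen_sqr _) _; apply: ler_sum => y _; apply: ler_wpM2l => //.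
  by rewrite le_eqVlt; apply/orP; left; apply/eqP; field.
apply: le_trans (ler_sum _ (fun o _ => step o)) _.
rewrite exchange_big /= le_eqVlt; apply/orP; left; apply/eqP.
transitivity (\sum_(y <- T) mu y * (\sum_o Psi o ^+ 2 - gradient Psi (a^~ y) / 4)); last first.
  rewrite (eq_bigr (fun y => mu y * \sum_o Psi o ^+ 2 - mu y * gradient Psi (a^~ y) / 4)).
    by rewrite sumrB -!mulr_suml mu_sum mul1r.
  by move=> y _; rewrite mulrBr mulrA.
apply: eq_bigr => y _; rewrite -mulr_sumr; congr (_ * _).
rewrite sumrB -!mulr_suml big_split /= /gradient.
have -> : \sum_o Psi (a o y) ^+ 2 = \sum_o Psi o ^+ 2.
  by rewrite [RHS](reindex_inj (@a_inj y)).
by field.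
Qed.

End LazyContraction.

Section LevelDecay.
Variables (R : realType) (d : nat) (ls : nat -> nat) (s : nat).
Notation l := (ls s).
Notation m := (circumference d l).
Notation G := (level_group d ls).
Hypothesis l_gt0 : (0 < l)%N.
Variables (mu : G -> R) (T : seq G) (mu_min : R) (K : nat).
Hypothesis T_uniq : uniq T.
Hypothesis mu_ge0 : forall x, 0 <= mu x.
Hypothesis mu_sum : \sum_(x <- T) mu x = 1.
Hypothesis mu_min_gt0 : 0 < mu_min.
Hypothesis mu_min_le : forall x, x \in T -> mu_min <= mu x.
Hypothesis letters : forall c, exists w : seq G,
  [/\ all (mem T) w, (size w <= K)%N & (\prod_(x <- w) x)%g = elt d ls [:: c]].

Implicit Types f : moments d l.

Definition level_act (st : state d l) (x : G) : state d l := act x s st.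

Lemma level_act_inj x : injective (level_act^~ x).
Proof. by move=> s1 s2 /(congr1 (act (x^-1)%g s)); rewrite /level_act !actK. Qed.

Lemma level_act_prod (w : seq G) st :
  foldl level_act st w = level_act st (\prod_(x <- w) x)%g.
Proof.
elim: w st => [|x w IH] st /=; first by rewrite big_nil.
by rewrite IH big_cons /level_act actM.
Qed.

(** Each letter is a product of at most [K] steps of mass at least [mu_min]. This compares the
    letters of the machine with an arbitrary [mu]. *)
Lemma gradient_letter (Psi : state d l -> R) c :
  gradient Psi (fun st => step st c) <=
  K%:R ^+ 2 * (energy mu T level_act Psi / mu_min).
Proof.
have [w [wT wK wc]] := letters c; set E := energy _ _ _ _.
have E_ge0 : 0 <= E by apply: sumr_ge0 => y _; rewrite mulr_ge0 ?gradient_ge0.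
have bound y : y \in T -> gradient Psi (level_act^~ y) <= E / mu_min.
  move=> yT; rewrite ler_pdivlMr // mulrC.
  apply: (@le_trans _ _ (mu y * gradient Psi (level_act^~ y))).
    by rewrite ler_wpM2r ?gradient_ge0 // mu_min_le.
  rewrite /E /energy (bigD1_seq y) //= lerDl.
  by apply: sumr_ge0 => z _; rewrite mulr_ge0 ?gradient_ge0.
have -> : (fun st => step st c) = (fun st => foldl level_act st w).
  by apply/funext => st; rewrite level_act_prod wc.
apply: le_trans (gradient_foldl level_act_inj bound wT) _.
apply: ler_wpM2r; first by rewrite divr_ge0 // ltW.
by rewrite lerXn2r ?nnegrE // ler_nat.
Qed.

(** Collects the constant of [poincare] without [m ^ 3], the loss in [gradient_letter] and the 1/4
    of [lazy_contraction]. *)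
Definition kappa : R := mu_min / (4 * (9 * 2 ^ d * d.+1 ^ 2)%:R * K%:R ^+ 2).

Lemma equivariant_lazy f (Psi : state d l -> R) n :
  equivariant f Psi -> equivariant f (iter n (lazy_avg mu T level_act) Psi).
Proof.
move=> h; elim: n => //= n; move: (iter _ _ _) => F hF X g z z'.
have key y : F (level_act (X, g, z + z') y) = character R f z' * F (level_act (X, g, z) y).
  rewrite /level_act -(word_ofK y) !act_elt.
  have [k [P [_ hP]]] := run_affine (word_of y) X.
  by rewrite !hP addrAC hF.
rewrite /lazy_avg hF /avg mulrA mulrDr mulr_sumr; congr ((_ + _) / _).
by apply: eq_bigr => y _; rewrite key mulrCA.
Qed.

Hypothesis K_gt0 : (0 < K)%N.

Lemma kappa_gt0 : 0 < kappa.
Proof.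
rewrite /kappa divr_gt0 // !mulr_gt0 ?exprn_gt0 ?ltr0n //.
by rewrite !muln_gt0 !expn_gt0.
Qed.

Definition decay : R := 1 - kappa / (m ^ 3)%:R.

Lemma decay_step f (Psi : state d l -> R) : (exists J, f J) -> equivariant f Psi ->
  \sum_o lazy_avg mu T level_act Psi o ^+ 2 <= decay * \sum_o Psi o ^+ 2.
Proof.
move=> [J fJ] eqP; apply: le_trans (lazy_contraction mu_ge0 mu_sum level_act_inj Psi) _.
rewrite /decay mulrBl mul1r lerD2l lerN2.
have := poincare l_gt0 fJ eqP (gradient_letter Psi).
set E := energy _ _ _ _; set N := \sum_o _; set c := (9 * _ * _)%N => hN.
have m0 : (0 : R) < (m ^ 3)%:R.
  by rewrite ltr0n expn_gt0 (ltn_trans _ (circumference_gt1 d l_gt0)).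
have c0 : (0 : R) < c%:R by rewrite ltr0n !muln_gt0 !expn_gt0.
have K0 : (0 : R) < K%:R by rewrite ltr0n.
have -> : kappa / (m ^ 3)%:R * N = N / (c%:R * (m ^ 3)%:R * (K%:R ^+ 2 / mu_min)) / 4.
  rewrite /kappa -/c; move: (c%:R : R) ((m ^ 3)%:R : R) (K%:R : R) c0 m0 K0 => u v w u0 v0 w0.
  by field; rewrite !gt_eqF.
rewrite ler_pM2r ?invr_gt0 ?ltr0n // ler_pdivrMr;
  last by rewrite !mulr_gt0 ?invr_gt0 ?exprn_gt0.
apply: le_trans hN _; rewrite natrM.
move: (c%:R : R) ((m ^ 3)%:R : R) (K%:R : R) => u v w.
by rewrite [leRHS](_ : _ = u * v * (w ^+ 2 * (E / mu_min))) //; ring.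
Qed.

Definition origin : state d l := (0, 0, 0).

Definition moment_character f : state d l -> R := fun st => character R f st.2.

(** Read off from [decay_step] at a nonzero equivariant function, whose left-hand side is
    nonnegative; no upper bound on [kappa] has to be computed. *)
Lemma decay_ge0 : 0 <= decay.
Proof.
have eqF : equivariant [ffun=> true] (moment_character [ffun=> true]).
  by move=> X g z z'; rewrite /moment_character characterD mulrC.
have := decay_step (ex_intro _ [ffun=> Ordinal l_gt0] _) eqF; rewrite ffunE => /(_ isT).
rewrite [X in _ * X](_ : _ = #|{: state d l}|%:R); last first.
  by rewrite (eq_bigr (fun=> 1)) ?sumr_const // => o _; rewrite character_sqr.
move=> h; have : 0 <= decay * #|{: state d l}|%:R.
  by apply: le_trans h; apply: sumr_ge0 => o _; exact: sqr_ge0.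
by rewrite pmulr_lge0 // ltr0n; apply/card_gt0P; exists origin.
Qed.

(** By equivariance the square of the iterate is constant in [z]. Keeping only the fibre of the
    origin in the square norm bounds the value there, with a factor [m * 2 ^ m] free of the number
    of moments. *)
Lemma moment_decay f n : (exists J, f J) ->
  iter n (lazy_avg mu T level_act) (moment_character f) origin ^+ 2 <=
  decay ^+ n * (m * 2 ^ m)%:R.
Proof.
move=> hf; pose F k := iter k (lazy_avg mu T level_act) (moment_character f).
have eqF k : equivariant f (F k).
  by apply: equivariant_lazy => X g z z'; rewrite /moment_character characterD mulrC.
have decay_F k : \sum_o F k o ^+ 2 <= decay ^+ k * \sum_o F 0%N o ^+ 2.
  elim: k => [|k IH]; first by rewrite expr0 mul1r.
  apply: le_trans (decay_step hf (eqF k)) _.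
  by rewrite exprS -mulrA ler_wpM2l // decay_ge0.
have F0 : \sum_o F 0%N o ^+ 2 = (m * 2 ^ m)%:R * #|{: moments d l}|%:R.
  rewrite (eq_bigr (fun=> 1)) => [|o _]; last by rewrite /F /= character_sqr.
  rewrite sumr_const -natrM -[#|_|]/#|{: 'Z_m * config d l * moments d l}|.
  rewrite !card_prod card_ffun card_bool !card_ord Zp_cast //.
  exact: circumference_gt1.
have c0 : (0 : R) < #|{: moments d l}|%:R.
  by rewrite ltr0n; apply/card_gt0P; exists 0.
rewrite -(ler_pM2r c0) -[leRHS]mulrA -F0; apply: le_trans (decay_F n).
rewrite mulr_natr -sumr_const.
rewrite (bigID (fun o : state d l => (o.1.1 == 0) && (o.1.2 == 0))) /= -[leLHS]addr0 lerD //.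
  rewrite (reindex_onto (fun z : moments d l => (0, 0, z) : state d l) (fun o => o.2)).
    rewrite le_eqVlt; apply/orP; left; apply/eqP; apply: eq_big => z.
      by rewrite !eqxx.
    move=> _; rewrite -[z]add0r (eqF n) exprMn character_sqr mul1r /origin.
    by [].
  by case=> [[X g] z] /= /andP[/eqP -> /eqP ->].
by apply: sumr_ge0 => o _; exact: sqr_ge0.
Qed.

(** Fourier inversion: the indicator of [x0] is at most that of producing the same moments as [x0]
    from [origin]. The trivial character gives the main term, the others contribute at most [b] on
    average. *)
Lemma point_mass_le n (x0 : G) (b : R) :
  (forall f, (exists J, f J) ->
     `|iter n (lazy_avg mu T level_act) (moment_character f) origin| <= b) ->
  iter n (lazy_avg mu T (@right_mul G)) (fun x => (x == x0)%:R) 1%g <=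
  (2 ^+ (l ^ d))^-1 + b.
Proof.
move=> hb; set N : R := 2 ^+ (l ^ d).
have N0 : 0 < N by rewrite exprn_gt0.
have card_m : #|{: moments d l}|%:R = N.
  by rewrite card_ffun card_bool card_ffun !card_ord natrX.
pose mom (x : G) := (level_act origin x).2.
have ind x : (x == x0)%:R <= N^-1 * \sum_f character R f (mom x0) * character R f (mom x).
  under eq_bigr do rewrite -characterD.
  rewrite sum_character; have [->|_] := eqVneq x x0.
    by rewrite addff eqxx mulVf ?gt_eqF.
  by apply: mulr_ge0; [rewrite invr_ge0 ltW|case: ifP => // _; exact: ltW].
apply: le_trans (lazy_avg_le T mu_ge0 _ _ _ ind) _.
rewrite lazy_avgZ lazy_avg_sum.
have term f : iter n (lazy_avg mu T (@right_mul G))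
      (fun x => character R f (mom x0) * character R f (mom x)) 1%g =
    character R f (mom x0) * iter n (lazy_avg mu T level_act) (moment_character f) origin.
  rewrite lazy_avgZ; congr (_ * _).
  have -> : origin = level_act origin 1%g by rewrite /level_act act1.
  rewrite -(lazy_avg_comp mu T (a := @right_mul G)) //.
  by move=> x y; rewrite /level_act -actM.
under eq_bigr do rewrite term.
rewrite (bigD1 (0 : moments d l)) //= mulrDr; apply: lerD.
  rewrite -[leRHS]mulr1 ler_wpM2l ?invr_ge0 ?(ltW N0) //.
  rewrite {1}/character /pair big1 => [|J _]; last by rewrite ffunE mul0r.
  rewrite expr0 mul1r (_ : moment_character 0 = fun=> 1) ?(lazy_avg_cst mu_sum) //.
  apply/funext => st; rewrite /moment_character /character /pair big1 // => J _.
  by rewrite ffunE mul0r.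
rewrite ler_pdivrMl //.
have b0 : 0 <= b.
  by apply: le_trans (hb [ffun=> true] _); [exact: normr_ge0|exists [ffun=> Ordinal l_gt0];
    rewrite ffunE].
apply: (@le_trans _ _ (\sum_(f : moments d l | f != 0) b)).
  apply: ler_sum => f f0; apply: le_trans (ler_norm _) _.
  rewrite normrM {1}/character normr_sign mul1r; apply: hb.
  apply/existsP; apply: contraNT f0 => /existsPn h.
  by apply/eqP/ffunP => J; rewrite ffunE; apply/negbTE/h.
rewrite -card_m mulr_natl; apply: (@le_trans _ _ (\sum_(f : moments d l) b)).
  by rewrite [leRHS](bigID (fun f => f != 0)) /= lerDl sumr_ge0.
by rewrite sumr_const.
Qed.

End LevelDecay.

(** * Mixing time and lower bound for the drift at one scale *)

Lemma bernoulli_ge (K : realDomainType) (x : K) n : 0 <= x -> 1 + n%:R * x <= (1 + x) ^+ n.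
Proof.
move=> x0; elim: n => [|n IH]; first by rewrite mul0r addr0 expr0.
rewrite exprS; apply: (@le_trans _ _ ((1 + x) * (1 + n%:R * x))).
  rewrite -natr1 -subr_ge0 (_ : _ - _ = n%:R * x ^+ 2); last by ring.
  by rewrite mulr_ge0 ?exprn_ge0.
by rewrite ler_wpM2l // addr_ge0.
Qed.

Lemma exprn_subr_le (K : realFieldType) (x : K) n : 0 <= x -> 0 <= 1 - x ->
  (1 - x) ^+ n * (1 + n%:R * x) <= 1.
Proof.
move=> x0 x1; apply: (@le_trans _ _ ((1 - x) ^+ n * (1 + x) ^+ n)).
  by rewrite ler_wpM2l ?exprn_ge0 // bernoulli_ge.
by rewrite -exprMn exprn_ile1 //; nra.
Qed.

Section DriftLowerBound.
Variables (R : realType) (d : nat) (ls : nat -> nat) (s : nat).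
Notation l := (ls s).
Notation m := (circumference d l).
Notation G := (level_group d ls).
Hypothesis d_ge2 : (2 <= d)%N.
Hypothesis l_ge : (d.+2 <= l)%N.
Variables (mu : G -> R) (T : seq G) (mu_min : R) (K : nat).
Hypothesis T_uniq : uniq T.
Hypothesis mu_ge0 : forall x, 0 <= mu x.
Hypothesis mu_sum : \sum_(x <- T) mu x = 1.
Hypothesis mu_min_gt0 : 0 < mu_min.
Hypothesis mu_min_le : forall x, x \in T -> mu_min <= mu x.
Hypothesis K_gt0 : (0 < K)%N.
Hypothesis letters : forall c, exists w : seq G,
  [/\ all (mem T) w, (size w <= K)%N & (\prod_(x <- w) x)%g = elt d ls [:: c]].
Variable N0 : nat.
Hypothesis N0_large : 16 <= (1 + kappa d mu_min K) ^+ N0.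

Let l_gt0 : (0 < l)%N. Proof. by apply: leq_trans l_ge. Qed.

Let D := (l ^ d)%N.

Lemma circumference_le : (m <= D)%N.
Proof.
apply: (@leq_trans (l * l)%N); first by rewrite leq_mul2r l_ge orbT.
by rewrite /D mulnn leq_pexp2l.
Qed.

Lemma D_ge4 : (4 <= D)%N.
Proof.
by apply: leq_trans circumference_le; have := leq_mul (leqnn d.+2) l_ge;
  rewrite /circumference; nia.
Qed.

(** Over [m ^ 3] steps the square norm loses a factor [1 + kappa], over [N0] such blocks a factor
    16. After [D] rounds, [16^(-D)] beats [m * 2 ^ m <= 4^D] and leaves the square of [2^(-D)]. *)
Definition mixing_time : nat := (m ^ 3 * N0 * D)%N.

Lemma decay_mixing_time :
  decay d ls s mu_min K ^+ mixing_time * (m * 2 ^ m)%:R <= (2 ^+ D)^-1 ^+ 2.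
Proof.
set ka := kappa d mu_min K; have N0l : 16 <= (1 + ka) ^+ N0 := N0_large;
  set de := decay d ls s mu_min K.
have m0 : (0 : R) < (m ^ 3)%:R.
  by rewrite ltr0n expn_gt0 (ltn_trans _ (circumference_gt1 d l_gt0)).
have ka0 : 0 < ka by exact: kappa_gt0.
have de0 : 0 <= de := decay_ge0 l_gt0 T_uniq mu_ge0 mu_sum mu_min_gt0 mu_min_le letters K_gt0.
have h1 : de ^+ (m ^ 3) * (1 + ka) <= 1.
  have := @exprn_subr_le _ (ka / (m ^ 3)%:R) (m ^ 3) (divr_ge0 (ltW ka0) (ltW m0)) de0.
  by rewrite [_%:R * _]mulrC divfK ?gt_eqF.
have h2 : (de ^+ (m ^ 3)) ^+ N0 * 16 <= 1.
  apply: (@le_trans _ _ ((de ^+ (m ^ 3)) ^+ N0 * (1 + ka) ^+ N0)).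
    by rewrite ler_wpM2l ?exprn_ge0.
  have ka1 : 0 <= 1 + ka by rewrite addr_ge0 // ltW.
  by rewrite -exprMn; apply: exprn_ile1 => //; rewrite mulr_ge0 ?exprn_ge0.
have h3 : (m * 2 ^ m)%:R <= (4 ^+ D : R).
  rewrite -natrX ler_nat; apply: (@leq_trans (2 ^ m * 2 ^ m)%N).
    by rewrite leq_mul2r ltnW ?orbT // ltn_expl.
  by rewrite -expnMn leq_exp2l // circumference_le.
rewrite /mixing_time 2!exprM; set u := (de ^+ _) ^+ _ in h2 *.
have u0 : 0 <= u by rewrite !exprn_ge0.
have hu : u <= 16^-1 by rewrite -[leRHS]mul1r ler_pdivlMr.
apply: (@le_trans _ _ ((16^-1) ^+ D * 4 ^+ D)).
  apply: ler_pM => //; first by rewrite exprn_ge0.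
  by rewrite lerXn2r ?nnegrE ?invr_ge0.
rewrite -exprMn -exprVn -exprM mulnC exprM.
by rewrite (_ : 16^-1 * 4 = 2^-1 ^+ 2) //; field.
Qed.

(** Every point has mass at most twice [2^(-D)], so a ball with at most [2^D / 4] elements has mass
    at most 1/2. Outside it the norm is at least [c]. *)
Lemma drift_lower (q : nat) (r : seq G) (S : set G) : (0 < q)%N ->
  ((size r).+1 <= 2 ^ q)%N -> S = [set` r] -> symmetric_set S -> generates S ->
  exists2 k, (k <= mixing_time)%N &
    D%:R <= (4 * q)%:R * iter k (avg mu T (@right_mul G)) (fun x => (word_norm S x)%:R) 1%g.
Proof.
move=> q0 rq Sr symS genS; pose F (x : G) : R := (word_norm S x)%:R.
have [k kn hk] := lazy_avg_le_avg mu T (@right_mul G) F mixing_time 1%g.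
exists k => //; apply: le_trans (ler_wpM2l (ler0n _ _) hk).
(* The radius [c.-1] is the integer part of [D / (2 q)]: the ball has at most [2^(D/2)] elements,
   and [D/2 + 2 <= D] since [D >= 4]. *)
set n := mixing_time; pose c := (D %/ (2 * q)).+1; pose B := ball r c.-1.
have D4 := D_ge4.
have point b : iter n (lazy_avg mu T (@right_mul G)) (fun x => (x == b)%:R) 1%g <=
    (2 ^+ D)^-1 + (2 ^+ D)^-1 :> R.
  apply: (point_mass_le l_gt0 mu_ge0 mu_sum) => f hf.
  rewrite -(ler_pXn2r (n := 2)) ?nnegrE ?invr_ge0 ?exprn_ge0 // real_normK ?num_real //.
  apply: le_trans decay_mixing_time.
  exact: (moment_decay l_gt0 T_uniq mu_ge0 mu_sum mu_min_gt0 mu_min_le letters K_gt0).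
have lower x : c%:R <= F x + \sum_(b <- B) c%:R * (x == b)%:R.
  have [xB|xB] := boolP (x \in B).
    rewrite (perm_big _ (perm_to_rem xB)) big_cons eqxx mulr1 addrCA lerDl.
    by rewrite addr_ge0 // sumr_ge0 // => b _; rewrite mulr_ge0.
  rewrite big_seq big1 => [|b bB]; last first.
    by case: eqVneq => [xb|]; rewrite ?mulr0 //; rewrite xb bB in xB.
  rewrite addr0 ler_nat ltnNge; apply: contra xB => xB.
  have [j hj] := word_length_exists symS genS x.
  exact: (mem_ball Sr (word_norm_spec hj).1).
have := lazy_avg_le T mu_ge0 (@right_mul G) n 1%g lower.
rewrite (lazy_avg_cst mu_sum) lazy_avgD lazy_avg_sum.
under eq_bigr do rewrite lazy_avgZ.
set LF := iter n _ F _; set Sg := \sum_(b <- B) _ => hLF.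
have hSg : Sg <= c%:R / 2.
  apply: (@le_trans _ _ (\sum_(b <- B) c%:R * ((2 ^+ D)^-1 + (2 ^+ D)^-1))).
    by apply: ler_sum => b _; rewrite ler_wpM2l // point.
  have hB : (size B * 4 <= 2 ^ D)%N.
    rewrite size_ball; apply: (@leq_trans (2 ^ (q * c.-1) * 2 ^ 2)%N).
      by rewrite leq_mul2r expnM; case: c.-1 => [|e]; rewrite ?expn0 ?leq_exp2r ?rq ?orbT.
    rewrite -expnD leq_exp2l //= /c /=.
    have := leq_divM D (2 * q); set t := (_ %/ _)%N; nia.
  have hBR : (size B)%:R * 4 <= (2 ^+ D : R) by rewrite -natrX -natrM ler_nat.
  rewrite big_const_seq count_predT iter_addr_0 -[leLHS]mulr_natr -mulrA.
  apply: ler_wpM2l => //; have N_gt0 : (0 : R) < 2 ^+ D by rewrite exprn_gt0.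
  have : (2 ^+ D)^-1 * ((size B)%:R * 4) <= 1 :> R by rewrite ler_pdivrMl // mulr1.
  by move: (size B)%:R (_^-1) => u v; lra.
have cD : D%:R <= (2 * q)%:R * c%:R :> R.
  by rewrite -natrM ler_nat mulnC ltnW // ltn_ceil // muln_gt0.
apply: le_trans cD _; rewrite !natrM; have q1 : (0 : R) < q%:R by rewrite ltr0n.
have : c%:R / 2 <= LF by lra.
nra.
Qed.

End DriftLowerBound.

(** * Choice of the scales *)

Section Scales.
Variable d : nat.

(** Finitely many finite machines admit finitely many joint actions; one representative satisfying
    [P] is kept for each action that occurs. *)
Lemma bounded_representatives (L : seq nat) (P : word -> Prop) :
  exists D, forall u, P u -> exists v,
    [/\ P v, (size v <= D)%N & forall l, l \in L -> @run d l u =1 @run d l v].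
Proof.
elim: L P => [|l L IH] P.
  have [[u Pu]|noP] := pselect (exists u, P u); last by exists 0%N => u Pu; case: noP;
    exists u.
  by exists (size u) => v _; exists u.
pose code u : {ffun state d l -> state d l} := [ffun s => run u s].
have [D hD] := choice (fun c => IH (fun u => P u /\ code u = c)).
exists (\max_c D c)%N => u Pu; have [v [[Pv cv] sv hv]] := hD (code u) u (conj Pu erefl).
exists v; split=> // [|k].
  by apply: leq_trans sv _; exact: leq_bigmax.
rewrite inE => /orP[/eqP -> s|/hv //].
by have /ffunP/(_ s) := cv; rewrite !ffunE.
Qed.

(** The scales are built recursively: those up to [s] determine the bound [Ds s], and only then is
    the next one chosen, large compared with it. *)
Lemma scales_exist : exists ls Ds : nat -> nat,
  [/\ forall s, (d.+2 + s <= ls s)%N,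
      forall s, (2 * Ds s < ls s.+1)%N /\ (s.+1 * ((Ds s + s.+1) ^ 2).+1 <= ls s.+1)%N,
      {homo ls : s s' / (s <= s')%N}
    & forall s u, same_lamps u [::] -> exists v,
        [/\ same_lamps v [::], (size v <= Ds s)%N
          & forall s', (s' <= s)%N -> @run d (ls s') u =1 @run d (ls s') v]].
Proof.
pose P u := same_lamps u [::].
have [rep hrep] := choice (fun L => bounded_representatives L P).
(* The three summands ensure growth, room for walks of time [(Ds s + s + 1)^2], and [2 * Ds s] below
   the new scale. *)
pose next s L := (last 0 L + s.+1 * ((rep L + s.+1) ^ 2).+1 + (2 * rep L).+1)%N.
pose fix hist s := if s is s'.+1 then rcons (hist s') (next s' (hist s')) else [:: d.+2].
pose ls s := last 0%N (hist s).
have lsS s : ls s.+1 = next s (hist s) by rewrite /ls /= last_rcons.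
have ls_le s : (ls s < ls s.+1)%N by rewrite lsS /next -/(ls s);
  move: (s.+1 * _)%N (2 * _)%N => p q; lia.
have ls_homo : {homo ls : s s' / (s <= s')%N}.
  apply: homo_leq => // [|s]; first exact: leq_trans.
  exact: ltnW.
exists ls, (fun s => rep (hist s)); split=> //.
- elim=> [|s IH]; first by rewrite addn0.
  by rewrite addnS; exact: (leq_ltn_trans IH (ls_le s)).
- by move=> s; rewrite lsS /next; move: (s.+1 * _)%N => p; split; lia.
- move=> s u Pu; have [v [Pv sv hv]] := hrep (hist s) u Pu.
  exists v; split=> // s' s's; apply: hv.
  elim: s s's {sv Pv} => [|s IH]; first by rewrite leqn0 => /eqP ->; rewrite /ls /= inE.
  rewrite leq_eqVlt => /orP[/eqP ->|/IH]; last by rewrite /= mem_rcons inE orbC => ->.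
  by rewrite lsS /= mem_rcons inE eqxx.
Qed.

End Scales.

(** * Short representatives below a large scale *)

Section ShortForm.
Variables (d : nat) (ls Ds : nat -> nat).
Notation G := (level_group d ls).
Notation elt := (elt d ls).
Hypothesis ls_ge : forall s, (d.+2 + s <= ls s)%N.

Lemma disp_elt u v : elt u = elt v -> disp u = disp v.
Proof.
(* At this scale the circumference exceeds the difference of displacements, so a difference that
   vanishes modulo it is zero. *)
move=> euv; pose s := `|(disp u - disp v)%R|%N.
have l0 : (0 < ls s)%N by apply: leq_trans (ls_ge s).
have := congr1 (fun x : G => (act x s (0, 0, 0)).1.1) euv.
have [h1 [P1 [_ hu]]] := @run_affine d (ls s) u 0.
have [h2 [P2 [_ hv]]] := @run_affine d (ls s) v 0.
rewrite !act_elt hu hv /= !add0r => /eqP; rewrite -subr_eq0 -intrB.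
rewrite (Zp_int_eq0 _ (circumference_gt1 d l0)) -/s => h.
have s_lt : (s < circumference d (ls s))%N.
  by have := ls_ge s; rewrite /circumference; nia.
have [s0|s0] := posnP s; first by lia.
by have := dvdn_leq s0 h; rewrite leqNgt s_lt.
Qed.

Definition shift_of (x : G) : int := disp (word_of x).

Lemma shift_ofV x : shift_of (x^-1)%g = - shift_of x.
Proof.
rewrite /shift_of -disp_inv; apply: disp_elt.
by rewrite elt_inv !word_ofK.
Qed.

Lemma disp_size u : `|disp u| <= (size u)%:Z.
Proof. by elim: u => //= c u; case: c => /=; lia. Qed.

Variable K : nat.
Let small (x : G) := (size (word_of x) <= K)%N.

(** Between steps the path is controlled by the two peaks; within a step it strays by at most
    [K]. *)
Lemma ranged_flatten (w : seq G) (lo hi x : int) : all small w ->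
  lo <= x - peak (fun y => - shift_of y) w - K%:Z -> x + peak shift_of w + K%:Z <= hi ->
  ranged lo hi x (flatten (map (@word_of d ls) w)).
Proof.
elim: w x => [|y w IH] x /=; first by move=> _ h1 h2; apply/andP; split; lia.
move=> /andP[sy sw]; have := peak_ge0 shift_of w.
have := peak_ge0 (fun y => - shift_of y) w.
set p := peak _ w; set q := peak _ w => p0 q0 h1 h2.
have p1 : - shift_of y + p <= Num.max 0 (- shift_of y + p) by rewrite le_max lexx orbT.
have q1 : shift_of y + q <= Num.max 0 (shift_of y + q) by rewrite le_max lexx orbT.
have p2 : 0 <= Num.max 0 (- shift_of y + p) by rewrite le_max lexx.
have q2 : 0 <= Num.max 0 (shift_of y + q) by rewrite le_max lexx.
move: p1 q1 p2 q2 h1 h2; set p' := Num.max _ _; set q' := Num.max _ _.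
move=> p1 q1 p2 q2 h1 h2; move: sy; rewrite /small => sy.
rewrite ranged_cat; apply/andP; split; first by apply: ranged_size; lia.
by apply: IH => //; rewrite -/(shift_of y) -/p -/q; lia.
Qed.

Lemma peak_le (delta : G -> int) (w : seq G) :
  (forall y, y \in w -> delta y <= K%:Z) -> peak delta w <= (K * size w)%:Z.
Proof.
elim: w => //= y w IH h; rewrite ge_max; apply/andP; split; first by lia.
have h1 := h y (mem_head _ _).
have h2 := IH (fun z zw => h z (@mem_behead _ (y :: w) z zw)).
by rewrite mulnS PoszD lerD.
Qed.

Lemma size_flatten_le (w : seq G) :
  all small w -> (size (flatten (map (@word_of d ls) w)) <= K * size w)%N.
Proof.
elim: w => //= y w IH /andP[sy /IH h]; rewrite size_cat.
by move: sy; rewrite /small => sy; rewrite mulnS leq_add.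
Qed.

Lemma elt_flatten (w : seq G) : elt (flatten (map (@word_of d ls) w)) = (\prod_(x <- w) x)%g.
Proof.
by elim: w => [|x w IH] /=; rewrite ?big_nil // elt_cat word_ofK big_cons IH.
Qed.

Hypothesis ls_homo : {homo ls : s s' / (s <= s')%N}.
Variable s : nat.
Hypothesis Ds_small : (2 * Ds s < ls s.+1)%N.
Hypothesis Ds_rep : forall u, same_lamps u [::] -> exists v,
  [/\ same_lamps v [::], (size v <= Ds s)%N
    & forall s', (s' <= s)%N -> @run d (ls s') u =1 @run d (ls s') v].

(* Walk along the range to reproduce the lamps; the remaining element is trivial
   at all the levels above [s], hence it has a representative of length [Ds s]. *)
Lemma short_form (w : seq G) : all small w ->
  (22 * K.+1 * (size w).+1 <= ls s.+1)%N ->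
  exists u, elt u = (\prod_(x <- w) x)%g /\
    (size u)%:Z <= (Ds s)%:Z +
      5 * (peak shift_of w + peak (fun y => - shift_of y) w + (2 * K)%:Z + 1).
Proof.
move=> sw lsw; set p := peak shift_of w; set q := peak (fun y => - shift_of y) w.
have p0 : 0 <= p := peak_ge0 _ _; have q0 : 0 <= q := peak_ge0 _ _.
have small_shift y : y \in w -> `|shift_of y| <= K%:Z.
  by move/(allP sw); rewrite /small => h; have := disp_size (word_of y);
    rewrite -/(shift_of y); lia.
have pK : p <= (K * size w)%:Z by apply: peak_le => y /small_shift; lia.
have qK : q <= (K * size w)%:Z by apply: peak_le => y /small_shift; lia.
set u := flatten (map (@word_of d ls) w).
have su : (size u <= K * size w)%N := size_flatten_le sw.
have [v [uv sv]] : exists v, same_lamps u v /\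
    (size v <= 5 * (`|(q + K%:Z)%R|%N + `|(p + K%:Z)%R|%N).+1)%N.
  by apply: tour_exists; apply: ranged_flatten => //; rewrite -/p -/q; lia.
have uv1 := same_lamps_divr uv; have [u' [u'1 su' hu']] := Ds_rep uv1.
have eu : elt (u ++ inv_word v) = elt u'.
  apply: act_inj => s' st; rewrite !act_elt.
  have [s's|ss'] := leqP s' s; first exact: hu'.
  have lss' := ls_homo ss'; have l0 : (0 < ls s')%N by apply: leq_trans (ls_ge s').
  rewrite !(run_same_lamps_nil l0) //;
    first by apply: leq_ltn_trans (leq_trans Ds_small lss'); rewrite leq_mul2l.
  (* With [n = size w], twice the length is at most [2 (K n + 5 (2 K n + 2 K + 1))], hence below
     [22 (K + 1) (n + 1)]. *)
  apply: leq_trans lss'; apply: leq_trans lsw.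
  rewrite size_cat /inv_word size_rev size_map.
  by move: (size w) su pK qK sv => n; nia.
exists (u' ++ v); split.
  by rewrite elt_cat -eu elt_cat elt_inv mulgVK elt_flatten.
by rewrite size_cat; lia.
Qed.

End ShortForm.

Lemma seq_upper_bound (I : eqType) (r : seq I) (f : I -> nat) :
  exists K, forall i, i \in r -> (f i <= K)%N.
Proof. by exists (\max_(i <- r) f i)%N => i ir; exact: leq_bigmax_seq. Qed.

Lemma seq_lower_bound (R : realDomainType) (I : eqType) (r : seq I) (f : I -> R) :
  (forall i, i \in r -> 0 < f i) -> exists2 c, 0 < c & forall i, i \in r -> c <= f i.
Proof.
elim: r => [|i r IH] hf; first by exists 1.
have [j jr|c c0 hc] := IH; first by apply: hf; rewrite inE jr orbT.
have fi := hf i (mem_head _ _).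
exists (Num.min (f i) c); first by rewrite lt_min fi.
move=> j; rewrite inE ge_min => /orP[/eqP ->|/hc ->]; rewrite ?lexx ?orbT //.
Qed.

Lemma foldl_right_mul (G : groupType) (w : seq G) (x : G) :
  foldl (@right_mul G) x w = (x * \prod_(y <- w) y)%g.
Proof.
elim: w x => [|y w IH] x /=; first by rewrite big_nil mulg1.
by rewrite IH big_cons /right_mul mulgA.
Qed.

(** * Bounds for the drift of a given walk *)

Section Drift.
Variables (d : nat) (ls Ds : nat -> nat).
Notation G := (level_group d ls).
Hypothesis ls_ge : forall s, (d.+2 + s <= ls s)%N.
Hypothesis ls_homo : {homo ls : s s' / (s <= s')%N}.
Hypothesis Ds_small : forall s, (2 * Ds s < ls s.+1)%N /\
  (s.+1 * ((Ds s + s.+1) ^ 2).+1 <= ls s.+1)%N.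
Hypothesis Ds_rep : forall s u, same_lamps u [::] -> exists v,
  [/\ same_lamps v [::], (size v <= Ds s)%N
    & forall s', (s' <= s)%N -> @run d (ls s') u =1 @run d (ls s') v].

Variables (R : realType) (S : set G) (r : seq G) (mu : G -> R) (T : seq G).
Hypothesis S_seq : S = [set` r].
Hypothesis S_sym : symmetric_set S.
Hypothesis S_gen : generates S.
Hypothesis T_uniq : uniq T.
Hypothesis T_support : mass_support mu = [set` T].
Hypothesis mu_ge0 : forall x, 0 <= mu x.
Hypothesis mu_sum : \sum_(x <- T) mu x = 1.
Hypothesis mu_sym : symmetric_measure mu.
Hypothesis mu_gen : generates (mass_support mu).

Let mem_T x : (x \in T) = (mu x != 0).
Proof.
have e : mass_support mu x = [set` T] x by rewrite T_support.
by apply/idP/idP => h; [rewrite -/(mass_support mu x)|]; move: h; rewrite -/([set` T] x) -e.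
Qed.

Let mu_out x : x \notin T -> mu x = 0.
Proof. by rewrite mem_T negbK => /eqP. Qed.

Definition mean_norm n : R :=
  iter n (avg mu T (@right_mul G)) (fun x => (word_norm S x)%:R) 1%g.

Lemma drift_mean_norm n : drift S mu n = mean_norm n.
Proof.
rewrite /mean_norm -(sum_convolution_power T_uniq mu_ge0 mu_out) /drift.
by apply: eq_fsbigr => x _; rewrite word_metric1.
Qed.

Lemma mean_normE n :
  mean_norm n = expect mu T n (fun w => (word_norm S (\prod_(y <- w) y)%g)%:R).
Proof.
rewrite /mean_norm iter_avg; apply: eq_expect => w.
by rewrite foldl_right_mul mul1g.
Qed.

Lemma letter_bound (A : set G) : symmetric_set A -> generates A ->
  exists2 K, (0 < K)%N & forall c, exists2 n, (n <= K)%N & is_word_length A (elt d ls [:: c]) n.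
Proof.
move=> symA genA; have len c := word_length_exists symA genA (elt d ls [:: c]).
have [n1 h1] := len Shift; have [n2 h2] := len Unshift.
have [n3 h3] := len LampA; have [n4 h4] := len LampB.
exists (n1 + n2 + n3 + n4).+1 => // -[];
  [exists n1|exists n2|exists n3|exists n4] => //; lia.
Qed.

(** Forces the times of the lower bound to tend to infinity. *)
Lemma mean_norm_le_linear : exists2 K, (0 < K)%N & forall n, mean_norm n <= (K * n)%:R.
Proof.
have [K hK] := seq_upper_bound T (word_norm S).
exists K.+1 => // n; rewrite mean_normE -(expect_cst mu_sum n (K.+1 * n)%:R).
apply: expect_le => // w <- wT; rewrite ler_nat.
elim: w wT => [|y w IH] /=; first by move=> _; rewrite big_nil;
  exact: leq_trans (word_norm_le (word_length1 S)) _.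
move=> /andP[yT /IH hw]; rewrite big_cons.
have [j1 /word_norm_spec[h1 _]] := word_length_exists S_sym S_gen y.
have [j2 /word_norm_spec[h2 _]] := word_length_exists S_sym S_gen (\prod_(z <- w) z)%g.
apply: leq_trans (word_norm_le (word_lengthM h1 h2)) _.
by rewrite mulnS leq_add // leqW // hK.
Qed.

(** The time is the square of [a = Ds s + s + 1]: the expected range is of order [a], and [a] also
    absorbs the additive constant [Ds s] of [short_form]. *)
Lemma mean_norm_upper : exists (C : R) s0, forall s, (s0 <= s)%N ->
  mean_norm ((Ds s + s.+1) ^ 2) <= C * (Ds s + s.+1)%:R.
Proof.
have [KS KS0 hKS] := letter_bound S_sym S_gen.
have elt_len u : exists2 n, (n <= KS * size u)%N & is_word_length S (elt d ls u) n.
  elim: u => [|c u [n nu hn]]; first by exists 0%N => //; exact: word_length1.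
  have [k kK hk] := hKS c; exists (k + n)%N; first by rewrite mulnS leq_add.
  by rewrite elt_cons; exact: word_lengthM.
have [K hK] := seq_upper_bound T (fun x => size (word_of x)).
pose de (x : G) : R := (shift_of x)%:~R; pose de' (x : G) : R := - de x.
exists (KS%:R * (1 + 5 * (2 * K%:R + 1) +
   5 * ((variance mu T de + 1) + (variance mu T de' + 1)))), (22 * K.+1)%N => s s0.
set a := (Ds s + s.+1)%N; have a0 : (0 < a)%N by rewrite /a addnS.
have de_inv x : x \in T -> de (x^-1)%g = - de x.
  by move=> _; rewrite /de (shift_ofV ls_ge) rmorphN.
have de'_inv x : x \in T -> de' (x^-1)%g = - de' x.
  by move=> xT; rewrite /de' de_inv.
have := expect_peak_le T_uniq mu_ge0 mu_out mu_sum a0 mu_sym de_inv.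
have := expect_peak_le T_uniq mu_ge0 mu_out mu_sum a0 mu_sym de'_inv.
set E' := expect _ _ _ _; set E := expect _ _ _ _ => hE' hE.
have bound w : size w = (a ^ 2)%N -> all (mem T) w ->
    (word_norm S (\prod_(y <- w) y)%g)%:R <=
    KS%:R * ((Ds s)%:R + 5 * (2 * K%:R + 1)) + (KS%:R * 5) * (peak de w + peak de' w).
  move=> sw wT.
  have small : all (fun x => (size (word_of x) <= K)%N) w.
    by apply/allP => x /(allP wT) /hK.
  have [|u [eu su]] := short_form ls_ge ls_homo (Ds_small s).1 (@Ds_rep s) small.
    (* The threshold [22 * K.+1] on [s] is what [short_form] requires here. *)
    rewrite sw; apply: leq_trans (Ds_small s).2; rewrite -/a.
    by rewrite leq_mul2r orbC ltnW.
  rewrite -eu; have [n nu hn] := elt_len u.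
  apply: (@le_trans _ _ (KS%:R * (size u)%:R)).
    by rewrite -natrM ler_nat; apply: leq_trans (word_norm_le hn) nu.
  rewrite -mulrA -mulrDr ler_wpM2l //.
  have := su; rewrite -(ler_int R) !(intrD, intrM) /= !peak_intr -!pmulrn.
  rewrite (_ : peak (fun y => (- shift_of y)%:~R) w = peak de' w); last first.
    by congr (peak _ w); apply/funext => y; rewrite rmorphN.
  rewrite -/de natrM; move: (peak de w) (peak de' w) => p q; lra.
rewrite mean_normE; apply: le_trans (expect_le mu_ge0 bound) _.
rewrite expectD (expect_cst mu_sum) expectZ expectD -/E -/E'.
have Da : (Ds s)%:R <= a%:R :> R by rewrite ler_nat leq_addr.
have a1 : 1 <= a%:R :> R by rewrite ler1n.
rewrite -!mulrA -mulrDr; apply: ler_wpM2l => //.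
have Ka : 0 <= K%:R * (a%:R - 1) :> R by rewrite mulr_ge0 // subr_ge0.
move: hE hE' Ka Da a1; move: (variance _ _ _) (variance _ _ _) => v v'.
by move: (K%:R : R) (a%:R : R) ((Ds s)%:R : R) => k x y; lra.
Qed.

Hypothesis d_ge2 : (2 <= d)%N.

Lemma mean_norm_lower : exists c q, [/\ (0 < c)%N, (0 < q)%N & forall s, exists k,
  (k <= c * ls s ^ (d + 3))%N /\ (ls s ^ d)%:R <= q%:R * mean_norm k].
Proof.
have supp_sym : symmetric_set (mass_support mu).
  by move=> x; rewrite /mass_support /= mu_sym.
have [K K0 hK] := letter_bound supp_sym mu_gen.
have letters c : exists w : seq G,
    [/\ all (mem T) w, (size w <= K)%N & (\prod_(x <- w) x)%g = elt d ls [:: c]].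
  have [n nK [w [wS sw pw]]] := hK c; exists w; split => //; last by rewrite sw.
  by apply/allP => x /wS; rewrite /mass_support /= mem_T.
have [|mm mm0 hmm] := @seq_lower_bound R _ T mu.
  by move=> x xT; rewrite lt_neqAle eq_sym -mem_T xT mu_ge0.
have ka0 := kappa_gt0 d mm0 K0; set ka := kappa d mm K in ka0.
(* By Bernoulli's inequality [N0 > 16 / kappa] suffices; this choice depends on [mu] but not on the
   scale. *)
pose N0 := Num.bound (16 / ka).
have N0_large : 16 <= (1 + ka) ^+ N0.
  apply: le_trans (bernoulli_ge N0 (ltW ka0)).
  have : 16 / ka < N0%:R by apply: archi_boundP; rewrite divr_ge0 // ltW.
  by rewrite ltr_pdivrMr // => h; rewrite ltW // ltr_wpDl.
pose q := (size r).+1.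
exists (d.+2 ^ 3 * N0).+1, (4 * q)%N; split => // s.
have l_ge : (d.+2 <= ls s)%N by apply: leq_trans (ls_ge s); rewrite leq_addr.
have rq : ((size r).+1 <= 2 ^ q)%N by rewrite ltnW // ltn_expl.
have [k kn hk] := drift_lower d_ge2 l_ge T_uniq mu_ge0 mu_sum mm0 hmm K0 letters
  N0_large (ltn0Sn _) rq S_seq S_sym S_gen.
exists k; split => //; apply: leq_trans kn _.
rewrite /mixing_time /circumference expnMn addnC expnD.
move: (d.+2 ^ 3)%N (ls s ^ 3)%N (ls s ^ d)%N => x y z.
have -> : (x * y * N0 * z = x * N0 * (y * z))%N by ring.
by rewrite leq_mul2r leqnSn orbT.
Qed.

End Drift.

(** * The exponent and the two sequences of times *)

Lemma nat_cvg_infty (f : nat -> nat) (c : nat) :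
  (forall i, (i <= c * f i)%N) -> f i @[i --> \oo] --> \oo.
Proof.
move=> h; apply/cvgnyPge => A; exists (c * A).+1 => // i /= cA.
by have := h i; case: (leqP A (f i)) => // fA; nia.
Qed.

Theorem corollary1p6 (R : realType) (beta : R) (hbeta : 1 / 2 < beta < 1) :
  exists G : groupType,
    [/\ finitely_generated G,
        nilpotent_by_cyclic G
      & forall S : set G,
          finite_set S -> symmetric_set S -> generates S ->
        forall mu : G -> R,
          finite_probability mu -> symmetric_measure mu ->
          generates (mass_support mu) ->
        exists (C : R) (t n : nat -> nat),
          [/\ 0 < C,
              t i @[i --> \oo] --> \oo,
              n i @[i --> \oo] --> \oo,
              forall i, drift S mu (t i) <= C * (t i)%:R `^ (1 / 2)
            & forall i, drift S mu (n i) >= 1 / C * (n i)%:R `^ beta]].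
Proof.
have /andP[beta_gt beta_lt1] := hbeta.
have beta0 : 0 < beta by lra.
have beta1 : 0 < 1 - beta by lra.
(* Chosen so that [(d + 3) beta <= d]; the two successors also ensure [d >= 2]. *)
pose d := (Num.bound (3 * beta / (1 - beta))).+2.
have d_beta : (d%:R + 3) * beta <= d%:R.
  have : 3 * beta / (1 - beta) < (Num.bound (3 * beta / (1 - beta)))%:R.
    by apply: archi_boundP; rewrite divr_ge0 ?mulr_ge0 // ltW.
  rewrite ltr_pdivrMr // /d; move: (Num.bound _) => x hx.
  by rewrite (_ : x.+2%:R = x%:R + 2) -?natrD ?addn2 //; lra.
have [ls [Ds [ls_ge Ds_small ls_homo Ds_rep]]] := scales_exist d.
exists (level_group d ls); split.
- exact: level_group_fg.
- exact: level_group_nilpotent_by_cyclic.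
move=> S /finite_seqP[r S_seq] S_sym S_gen mu [mu_ge0 finT mu_1] mu_sym mu_gen.
have [T0 T0_supp] := (iffLR (finite_seqP _)) finT; pose T := undup T0.
have T_supp : mass_support mu = [set` T].
  by rewrite T0_supp; apply/seteqP; split => x /=; rewrite mem_undup.
have T_uniq : uniq T by exact: undup_uniq.
have mu_out x : x \notin T -> mu x = 0.
  move=> xT; apply/eqP; apply: contraNT xT => mux.
  by have : mass_support mu x := mux; rewrite T_supp.
have mu_sum : \sum_(x <- T) mu x = 1 by rewrite -(fsum_seq T_uniq mu_out).
have d2 : (2 <= d)%N by [].
have driftE := drift_mean_norm S T_uniq T_supp mu_ge0.
have [C1 [s0 upper]] := mean_norm_upper ls_ge ls_homo Ds_small Ds_rep S_sym S_gen
  T_uniq T_supp mu_ge0 mu_sum mu_sym.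
have [c [q [c0 q0 /choice[k lower]]]] := mean_norm_lower ls_ge S_seq S_sym S_gen
  T_uniq T_supp mu_ge0 mu_sum mu_sym mu_gen d2.
have [KT KT0 linear] := mean_norm_le_linear S_sym S_gen mu_ge0 mu_sum.
pose a i := (Ds (i + s0) + (i + s0).+1)%N.
have cq0 : (0 : R) < (c * q)%:R by rewrite ltr0n muln_gt0 c0.
(* The sign of [C1] is unknown, hence the maximum; one constant must serve both bounds. *)
exists (Num.max C1 0 + (c * q)%:R), (fun i => a i ^ 2)%N, k; split.
- by rewrite ltr_wpDl // le_max lexx orbT.
- apply: (nat_cvg_infty (c := 1)) => i; rewrite mul1n.
  by apply: (@leq_trans (a i)); [rewrite /a; lia|rewrite -mulnn leq_pmulr // /a addnS].
(* The chain is [i <= ls i <= ls i ^ d <= q * mean_norm (k i) <= q * KT * k i]. *)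
- apply: (nat_cvg_infty (c := q * KT)) => i; have [_ hi] := lower i.
  rewrite -(ler_nat R); apply: le_trans (_ : (ls i ^ d)%:R <= _).
    rewrite ler_nat; apply: (@leq_trans (ls i)); first by apply: leq_trans (ls_ge i); lia.
    by rewrite -{1}(expn1 (ls i)) leq_pexp2l // (leq_trans _ (ls_ge i)).
  apply: le_trans hi _; rewrite -mulnA natrM ler_wpM2l //.
- move=> i; rewrite driftE; apply: le_trans (upper _ (leq_addl _ _)) _.
  rewrite -/(a i) natrX div1r powR12_sqrt ?exprn_ge0 // sqrtr_sqr ger0_norm //.
  by rewrite ler_wpM2r // ler_wpDr ?(ltW cq0) // le_max lexx.
- move=> i; rewrite driftE; have [ki hi] := lower i.
  set C := _ + _; have C0 : 0 < C by rewrite /C ltr_wpDl // le_max lexx orbT.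
  rewrite div1r ler_pdivrMl //.
  have l1 : 1 <= (ls i)%:R :> R by rewrite ler1n (leq_trans _ (ls_ge i)).
  have mean0 : 0 <= mean_norm S mu T (k i).
    by rewrite -(pmulr_rge0 _ (_ : 0 < q%:R)) ?ltr0n // (le_trans _ hi).
  apply: (@le_trans _ _ ((c * q)%:R * mean_norm S mu T (k i))); last first.
    by rewrite ler_wpM2r // ler_wpDl // le_max lexx orbT.
  apply: (@le_trans _ _ (c%:R * (ls i ^ d)%:R)); last first.
    by rewrite natrM -mulrA ler_wpM2l.
  apply: (@le_trans _ _ ((c * ls i ^ (d + 3))%:R `^ beta)).
    by apply: ge0_ler_powR; rewrite ?nnegrE ?ler_nat // ltW.
  (* The factor [c] only grows when its exponent [beta] is raised to 1, and [(d + 3) beta <= d]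
     compares the powers of [ls i]. *)
  rewrite natrM powRM // ler_pM ?powR_ge0 //.
    rewrite -[leRHS](powRr1 (ler0n _ _)); apply: ler_powR; last exact: ltW.
    by rewrite ler1n.
  rewrite !natrX -(powR_mulrn _ (ler0n _ (ls i))) -powRrM -(powR_mulrn _ (ler0n _ (ls i))).
  by apply: ler_powR => //; rewrite natrD.
Qed.
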